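(* Let $K$ be a field and let $G$ be a finite simple graph without isolated vertices and with $E_G\neq\emptyset$. Then the Castelnuovo--Mumford regularity of the Eulerian ideal $I(X_G)$ is the maximum cardinality of minimum fixed parity $T$-joins, i.e. $$\operatorname{reg} I(X_G)=\max\{\tau_i(G,T) : T\in\mathcal{E}(V_G),\ i\in\mathbb{Z}/2,\ \mathcal{J}_i(G,T)\neq\emptyset\},$$ or, equivalently, $\operatorname{reg} I(X_G)$ is the maximum cardinality of a parity join of $G$.
   Context: $G$ has vertex set $V_G$ and edge set $E_G$, a non-empty set of $2$-element subsets of $V_G$. Put $K[V_G]=K[x_i : i\in V_G]$ and $K[E_G]=K[t_h : h\in E_G]$ with the standard grading. Let $\varphi\colon K[E_G]\to K[V_G]$ be the $K$-algebra homomorphism with $\varphi(t_h)=x_ix_j$ for $h=\{i,j\}\in E_G$. The Eulerian ideal of $G$ is $I(X_G)=\varphi^{-1}\big((x_i^2-x_j^2 : i,j\in V_G)\big)\subset K[E_G]$; it is homogeneous. For a nonzero finitely generated graded module $M$ over a polynomial ring $S$ with minimal graded free resolution having modules $F_i=\bigoplus_{j\in\mathbb{Z}}S(-j)^{\beta_{ij}}$, $\operatorname{reg}M=\max\{j-i : \beta_{ij}\neq 0\}$. By convention $\operatorname{reg}0=1$ (so $\operatorname{reg}I(X_G)=1$ when $I(X_G)=0$). $\mathcal{E}(V_G)$ is the set of even subsets of vertices: subsets $T\subset V_G$ such that $|T\cap V_H|$ is even for every connected component $H$ of $G$. A $T$-join is a subset $J\subset E_G$ such that $T$ is precisely the set of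 odd degree vertices of the subgraph edge-induced by $J$. For $T\in\mathcal{E}(V_G)$ and $i\in\mathbb{Z}/2$, $\mathcal{J}_i(G,T)$ is the set of $T$-joins $J$ with $|J|+2\mathbb{Z}=i$, and $\tau_i(G,T)$ is the minimum cardinality of an element of $\mathcal{J}_i(G,T)$, defined when $\mathcal{J}_i(G,T)\neq\emptyset$. The minimum cardinality elements of the sets $\mathcal{J}_i(G,T)$ are called minimum fixed parity $T$-joins. A subgraph of $G$ is called even Eulerian if all its vertices have even degree in the subgraph and its edge set has even cardinality (it need be neither connected nor spanning). A parity join is a subset $J\subset E_G$ such that $|J\cap E_C|\leq |E_C|/2$ for every even Eulerian subgraph $C$ of $G$. *)

(* Defs.v *)
From HB Require Import structures.
From mathcomp Require Import all_boot all_order all_algebra.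
From mathcomp Require Import mpoly.

Set Implicit Arguments.
Unset Strict Implicit.
Unset Printing Implicit Defensive.

Import GRing.Theory Num.Theory.
Local Open Scope ring_scope.

Section Regularity.

Variables (K : fieldType) (n : nat).
Local Notation S := {mpoly K[n]}.

(* The degree d component of the standard graded ring S, for d in Z; it is
   zero when d < 0. *)
Definition homog_of_degree (d : int) (p : S) : Prop :=
  match d with
  | Posz m => p \is m.-homog
  | Negz _ => p = 0
  end.

(* F_i is the direct sum of the S(- gshift i k), k < grank i, and its elements
   are row vectors.  The map F_(i+1) -> F_i is right multiplication by gdiff i,
   and the augmentation F_0 -> S is right multiplication by gaug. *)
Record free_complex := FreeComplex {
  grank : nat -> nat;
  gshift : forall i, 'I_(grank i) -> int;
  gaug : 'cV[S]_(grank 0);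
  gdiff : forall i, 'M[S]_(grank i.+1, grank i)
}.

(* The homogeneity conditions say that all the maps have degree 0: the basis
   element k of F_i has degree gshift i k. *)
Definition graded_free_resolution (F : free_complex) (I : S -> Prop) : Prop :=
  [/\ forall k, homog_of_degree (gshift k) (gaug F k 0),
      forall i (k : 'I_(grank F i.+1)) (l : 'I_(grank F i)),
        homog_of_degree (gshift k - gshift l) (gdiff F i k l),
      forall p, I p <-> exists v : 'rV[S]_(grank F 0), (v *m gaug F) 0 0 = p,
      forall v : 'rV[S]_(grank F 0),
        v *m gaug F = 0 <-> exists w, v = w *m gdiff F 0
    & forall i (v : 'rV[S]_(grank F i.+1)),
        v *m gdiff F i = 0 <-> exists w, v = w *m gdiff F i.+1].

(* The image of F_(i+1) lies in m F_i, where m is the ideal of the variables. *)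
Definition minimal_complex (F : free_complex) : Prop :=
  forall i k l, (gdiff F i k l)@_0%MM = 0.

Definition betti (F : free_complex) (i : nat) (j : int) : nat :=
  #|[set k : 'I_(grank F i) | gshift k == j]|.

(* The graded Betti numbers do not depend on the minimal resolution, so r is
   determined by I.  The zero ideal has regularity 1 by convention. *)
Definition has_regularity (I : S -> Prop) (r : int) : Prop :=
  ((forall p, I p -> p = 0) /\ r = 1) \/
  ((exists2 p, I p & p != 0) /\
   exists F : free_complex,
     [/\ graded_free_resolution F I, minimal_complex F,
         exists i j, betti F i j != 0%N /\ j - i%:Z = r
       & forall i j, betti F i j != 0%N -> j - i%:Z <= r]).

End Regularity.

Record simple_graph (V : finType) := SimpleGraph {
  edges : {set {set V}};
  card_edge : forall h, h \in edges -> #|h| = 2%N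
}.

Section Graphs.

Variables (V : finType) (G : simple_graph V).

Definition no_isolated_vertex : Prop :=
  forall v : V, exists2 h, h \in edges G & v \in h.

Definition adjacent : rel V := [rel x y | [set x; y] \in edges G].

Definition component (x : V) : {set V} := [set y | connect adjacent x y].

Definition even_vertex_sets : {set {set V}} :=
  [set T : {set V} | [forall x, ~~ odd #|T :&: component x|]].

Definition edge_degree (J : {set {set V}}) (v : V) : nat :=
  #|[set h in J | v \in h]|.

(* A vertex outside of the subgraph edge-induced by J has degree 0 here, hence
   is not in this set. *)
Definition odd_vertices (J : {set {set V}}) : {set V} :=
  [set v | odd (edge_degree J v)].

Definition is_join (T : {set V}) (J : {set {set V}}) : bool :=
  (J \subset edges G) && (odd_vertices J == T).

Definition parity_T_joins (i : 'Z_2) (T : {set V}) : {set {set {set V}}} :=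
  [set J : {set {set V}} | is_join T J & #|J|%:R == i].

(* The default value is an upper bound on the cardinality of all joins, so this
   is the minimum as soon as parity_T_joins i T is not empty. *)
Definition tau (i : 'Z_2) (T : {set V}) : nat :=
  \big[minn/#|edges G|]_(J in parity_T_joins i T) #|J|.

Definition max_tau : nat :=
  \max_(p : 'Z_2 * {set V} |
        (p.2 \in even_vertex_sets) && (parity_T_joins p.1 p.2 != set0))
     tau p.1 p.2.

(* Subgraphs are given by their edge sets: isolated vertices of a subgraph have
   degree 0 and do not affect this condition. *)
Definition even_eulerian (C : {set {set V}}) : bool :=
  [&& C \subset edges G, [forall v, ~~ odd (edge_degree C v)] & ~~ odd #|C|].

(* #|C| is even, so #|C|./2 is an exact half. *)
Definition parity_join (J : {set {set V}}) : bool :=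
  (J \subset edges G) &&
  [forall C : {set {set V}}, even_eulerian C ==> (#|J :&: C| <= #|C|./2)%N].

Definition max_parity_join : nat :=
  \max_(J : {set {set V}} | parity_join J) #|J|.

End Graphs.

Section EulerianIdeal.

Variables (K : fieldType) (V : finType) (G : simple_graph V).

(* K[V_G] is {mpoly K[#|V|]} and K[E_G] is {mpoly K[#|edges G|]}, with the
   variables numbered by the enumerations of V and of edges G. *)
Definition vertex_var (v : V) : {mpoly K[#|V|]} := 'X_(enum_rank v).

Definition edge_map (p : {mpoly K[#|edges G|]}) : {mpoly K[#|V|]} :=
  p \mPo [tuple \prod_(v in enum_val h) vertex_var v | h < #|edges G|].

Definition square_difference_ideal (q : {mpoly K[#|V|]}) : Prop :=
  exists c : V -> V -> {mpoly K[#|V|]},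
    q = \sum_i \sum_j c i j * (vertex_var i ^+ 2 - vertex_var j ^+ 2).

Definition eulerian_ideal (p : {mpoly K[#|edges G|]}) : Prop :=
  square_difference_ideal (edge_map p).

End EulerianIdeal.

(* Main.v *)
(* A monomial t^m is determined modulo I = I(X_G) by its degree d and by the set T of
   vertices of odd degree in the multigraph m; so the degree d part of S/I has as basis
   the sets T having a T-join of size at most d and of the parity of d, every variable t
   is a nonzerodivisor on S/I, and the top degree of S/(I, t) is max tau - 1.

   The Betti numbers of I are read off its Koszul homology: if N' is the kernel of a
   minimal cover of N, then H_q(N') is H_(q+1)(N), so that the generators of the i-th
   syzygy module live in the degrees of H_i(I), that is, of H_(i+1)(S/I). As t acts
   trivially on Koszul homology, a chain divisible by t modulo I is irrelevant, which
   bounds the degrees; a socle element a of S/(I, t) of top degree yields the nonzero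
   class t^-1 d(a e_1 ... e_n) in degree n - 1, which shows that the bound is reached.
   The bound also makes every syzygy module generated in finitely many degrees, so that
   the minimal resolution exists without Noetherianity. *)
Require Import Defs.
From HB Require Import structures.
From mathcomp Require Import all_boot all_order all_algebra.
From mathcomp Require Import ring mpoly ssrcomplements.
From Stdlib Require Import Classical ClassicalEpsilon.

Set Implicit Arguments.
Unset Strict Implicit.
Unset Printing Implicit Defensive.

Import GRing.Theory Num.Theory.
Local Open Scope ring_scope.

(** * Graded free modules *)

Lemma classical_choice (A : Type) (B : A -> Type) (P : forall a, B a -> Prop) :
  (forall a, exists b, P a b) -> exists f, forall a, P a (f a).
Proof.
move=> h; exists (fun a => proj1_sig (constructive_indefinite_description _ (h a))).
by move=> a; case: constructive_indefinite_description.
Qed.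

Section Grading.

Variables (K : fieldType) (n : nat).
Local Notation S := {mpoly K[n]}.

Lemma mcoeff_mulX (j : 'I_n) (p : S) m :
  ('X_j * p)@_m = if (0 < m j)%N then p@_(m - U_(j)) else 0.
Proof.
rewrite mulrC; case: ifPn => [mj | ].
  have -> : m = (U_(j) + (m - U_(j)))%MM.
    by apply/mnmP => i; rewrite mnmDE mnmBE mnm1E; case: eqP => [<-|//]; rewrite subnKC.
  rewrite mcoeffMX; congr (p@__).
  by apply/mnmP => i; rewrite !(mnmDE, mnmBE, mnm1E) addKn.
rewrite -eqn0Ngt => /eqP mj; apply/eqP; rewrite mcoeff_eq0; apply/negP.
rewrite (perm_mem (msuppMX p U_(j))) => /mapP[m' _ e].
by move: mj; rewrite e mnmDE mnm1E eqxx.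
Qed.

Lemma mcoeff_pihomog d (p : S) m :
  (pihomog mdeg d p)@_m = if mdeg m == d then p@_m else 0.
Proof.
rewrite [p in RHS]mpolyE pihomogE !raddf_sum /= big_mkcond /=.
case: ifPn => md.
  apply: eq_bigr => m' _; case: ifPn => // md'; rewrite mcoeffZ mcoeffX.
  case: eqP => [e|_]; last by rewrite mulr0.
  by rewrite e md in md'.
rewrite big1 // => m' _; case: ifPn => md' //.
rewrite mcoeffZ mcoeffX; case: eqP => [e|]; last by rewrite mulr0.
by rewrite -e md' in md.
Qed.

Lemma pihomogM d e (p q : S) : q \is e.-homog ->
  pihomog mdeg d (p * q) =
    if (e <= d)%N then pihomog mdeg (d - e) p * q else 0.
Proof.
move=> hq; rewrite [p in LHS]mpolyE mulr_suml raddf_sum /=.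
have hom m : p@_m *: 'X_[m] * q \is (mdeg m + e).-homog.
  by apply: dhomogM => //; apply: dhomogZ; rewrite dhomogX.
case: ifPn => ed; last first.
  rewrite big1 // => m _; apply: pihomog_ne0 (hom m).
  by apply: contraNneq ed => <-; rewrite leq_addl.
rewrite pihomogE mulr_suml [RHS]big_mkcond; apply: eq_bigr => m _.
case: ifPn => md; first by rewrite pihomog_dE // -(subnK ed) -(eqP md).
apply: pihomog_ne0 (hom m); apply: contraNneq md => <-.
by rewrite addnK.
Qed.

(* The degree [d] part of the free module with basis in degrees [a]. *)
Definition hproj g (a : 'I_g -> nat) (d : nat) (v : 'rV[S]_g) : 'rV[S]_g :=
  \row_k (if (a k <= d)%N then pihomog mdeg (d - a k) (v 0 k) else 0).

(** Homogeneity is invariance under the projection, so that it passes by rewriting through any map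
    commuting with [hproj]. *)
Definition vhom g (a : 'I_g -> nat) (d : nat) (v : 'rV[S]_g) : Prop :=
  hproj a d v = v.

Lemma hproj_is_additive g (a : 'I_g -> nat) d : additive (hproj a d).
Proof.
move=> u v; apply/rowP => k; rewrite !mxE; case: ifP => _; rewrite ?subr0 //.
by rewrite raddfB.
Qed.

HB.instance Definition _ g (a : 'I_g -> nat) d :=
  GRing.isZmodMorphism.Build _ _ (hproj a d) (@hproj_is_additive g a d).

Lemma vhom_hproj g (a : 'I_g -> nat) d v : vhom a d (hproj a d v).
Proof.
apply/rowP => k; rewrite !mxE; by case: ifP => h; rewrite ?h ?pihomog_id.
Qed.

Lemma vhomP g (a : 'I_g -> nat) d v :
  vhom a d v <-> forall k, if (a k <= d)%N then is_true (v 0 k \is (d - a k).-homog)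
                           else v 0 k = 0.
Proof.
split=> [hv k|h].
  by rewrite -hv mxE; case: ifP => h; rewrite h //; apply: pihomogP.
apply/rowP => k; rewrite !mxE; move: (h k); case: ifP => // _; exact: pihomog_dE.
Qed.

Lemma hproj_sum_all g (a : 'I_g -> nat) (v : 'rV[S]_g) :
  exists N, v = \sum_(d < N) hproj a d v.
Proof.
pose M k := (a k + msize (v 0%R k))%N.
(* From degree [M k] on, coordinate [k] has no homogeneous part left. *)
exists (\max_k M k)%N; apply/rowP => k.
have hk : (M k <= \max_k M k)%N by exact: leq_bigmax.
rewrite summxE -(subnKC (leq_trans (leq_addr _ _) hk)).
pose F d := if (a k <= d)%N then pihomog mdeg (d - a k) (v 0 k) else 0.
rewrite (eq_bigr (fun d : 'I__ => F d)); last by move=> d _; rewrite mxE.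
rewrite -(big_mkord xpredT F).
rewrite (@big_cat_nat _ _ _ (a k)) //= ?leq_addr //.
rewrite big_nat_cond big1 ?add0r => [|d /andP[/andP[_ h] _]]; last first.
  by rewrite /F leqNgt h.
rewrite -{1}[a k]add0n big_addn addKn big_mkord.
rewrite {1}(@pihomog_partitionE _ _ mdeg (\max_k M k - a k) (v 0 k)); last first.
  by rewrite leq_subRL ?(leq_trans _ hk) ?leq_addr.
by apply: eq_bigr => d _; rewrite /F leq_addl addnK.
Qed.

Lemma hprojZ g (a : 'I_g -> nat) d e (c : S) v : c \is e.-homog ->
  hproj a d (c *: v) = if (e <= d)%N then c *: hproj a (d - e) v else 0.
Proof.
move=> hc; apply/rowP => k; rewrite !mxE mulrC.
case: ifP => h; last case: ifP => h'.
- rewrite (pihomogM _ _ hc); case: ifP => h1.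
    have ed : (e <= d)%N by rewrite (leq_trans h1) ?leq_subr.
    by rewrite ed !mxE leq_subRL // addnC -leq_subRL // h1 mulrC subnAC.
  case: ifP => ed; rewrite !mxE // leq_subRL // addnC -leq_subRL // h1.
  by rewrite mulr0.
- rewrite !mxE ifN ?mulr0 //; apply: contraFN h => h.
  by rewrite (leq_trans h) ?leq_subr.
by rewrite mxE.
Qed.

(** The hypothesis makes [B] a map of degree 0 between graded free modules. *)
Lemma hproj_mul g g' (a : 'I_g -> nat) (a' : 'I_g' -> nat) (B : 'M[S]_(g', g)) d w :
  (forall k, vhom a (a' k) (row k B)) ->
  hproj a d (w *m B) = hproj a' d w *m B.
Proof.
move=> hB; apply/rowP => l; rewrite !mxE.
have hb k := (vhomP _ _ _).1 (hB k) l.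
case: ifP => h; last first.
  rewrite big1 // => k _; rewrite mxE; case: ifP => h'; rewrite ?mul0r //.
  move: (hb k); rewrite mxE ifF => [->|]; first by rewrite mulr0.
  by apply: contraFF h => h; rewrite (leq_trans h).
rewrite raddf_sum; apply: eq_bigr => k _; rewrite mxE.
move: (hb k); rewrite mxE; case: ifP => h1 hk; last by rewrite hk !mulr0 raddf0.
rewrite /= (pihomogM _ _ hk) leq_sub2rE // subnBA // subnK //.
by case: ifP; rewrite ?mul0r.
Qed.

Lemma vhom_homog_of_degree g (a : 'I_g -> nat) d v k : vhom a d v ->
  homog_of_degree (Posz d - Posz (a k)) (v 0 k).
Proof.
move/vhomP/(_ k); case: ifP => h; first by rewrite subzn.
move=> ->; rewrite /homog_of_degree; case: (_ - _) => // m; exact: rpred0.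
Qed.

End Grading.

(** * Koszul homology *)

Section Koszul.

Variables (K : fieldType) (n g : nat).
Local Notation S := {mpoly K[n]}.
Local Notation chain := ({set 'I_n} -> 'rV[S]_g).
Implicit Types (z w : chain) (A : {set 'I_n}).

Definition below (j : 'I_n) A : nat := #|[set k in A | (k < j)%N]|.

(** The Koszul differential of the variables on a free module of rank [g]. A chain stores the
    coefficient of each exterior monomial e_A, in all homological degrees at once; [below] is the
    position giving the sign. *)
Definition kd z : chain := fun A =>
  \sum_(j | j \notin A) (-1) ^+ below j A *: ('X_j *: z (j |: A)).

Lemma belowU1 (j k : 'I_n) A : k \notin A ->
  below j (k |: A) = ((k < j) + below j A)%N.
Proof.
move=> kA; rewrite /below; case: (ltnP k j) => kj.
  have -> : [set l in k |: A | (l < j)%N] = k |: [set l in A | (l < j)%N].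
    by apply/setP => l; rewrite !inE; case: eqP => [->|//]; rewrite kj.
  by rewrite cardsU1 inE (negbTE kA).
congr #|pred_of_set _|; apply/setP => l; rewrite !inE; case: eqP => [->|//].
by rewrite ltnNge kj (negbTE kA).
Qed.

(** Inserting [k] moves the position of [j] exactly when k < j, and exactly one of k < j and j < k
    holds, whence one extra sign. *)
Lemma sign_swapU (j k : 'I_n) A : j \notin A -> k \notin A -> j != k ->
  (-1) ^+ below j (k |: A) * (-1) ^+ below k (j |: A)
  = - ((-1) ^+ below j A * (-1) ^+ below k A) :> S.
Proof.
move=> jA kA jk; rewrite !belowU1 // !exprD.
have -> : (j < k)%N = ~~ (k < j)%N.
  by rewrite -leqNgt ltn_neqAle (inj_eq val_inj) jk.
case: (k < j)%N; rewrite /= ?expr0 ?expr1; ring.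
Qed.

Lemma sign_swap (j k : 'I_n) A : j \notin A -> k \notin A -> j != k ->
  (-1) ^+ below j A * (-1) ^+ below k (j |: A)
  = - ((-1) ^+ below k A * (-1) ^+ below j (k |: A)) :> S.
Proof.
move=> jA kA jk; rewrite !belowU1 // !exprD.
have -> : (j < k)%N = ~~ (k < j)%N.
  by rewrite -leqNgt ltn_neqAle (inj_eq val_inj) jk.
case: (k < j)%N; rewrite /= ?expr0 ?expr1; ring.
Qed.

Lemma kd_sub z w A : kd (fun B => z B - w B) A = kd z A - kd w A.
Proof.
by rewrite /kd -sumrB; apply: eq_bigr => j _; rewrite !scalerBr.
Qed.

Lemma kd_add z w A : kd (fun B => z B + w B) A = kd z A + kd w A.
Proof.
by rewrite /kd -big_split; apply: eq_bigr => j _; rewrite !scalerDr.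
Qed.

Lemma kd_scale (c : S) z A : kd (fun B => c *: z B) A = c *: kd z A.
Proof.
rewrite /kd scaler_sumr; apply: eq_bigr => j _.
by rewrite !scalerA; congr (_ *: _); ring.
Qed.

Lemma eq_kd z w A : z =1 w -> kd z A = kd w A.
Proof. by move=> e; apply: eq_bigr => j _; rewrite e. Qed.

Lemma kd_kd z A : kd (kd z) A = 0.
Proof.
pose f (j k : 'I_n) := ((-1) ^+ below j A * (-1) ^+ below k (j |: A)) *:
   (('X_j * 'X_k) *: z (k |: (j |: A))).
have fE j k : j \notin A -> k \notin A -> j != k -> f j k = - f k j.
  move=> jA kA jk; rewrite /f sign_swap // scaleNr; congr (- (_ *: _)).
  by rewrite setUCA mulrC.
have -> : kd (kd z) A = \sum_(j | j \notin A) \sum_(k | (k \notin A) && (j != k)) f j k.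
  apply: eq_bigr => j jA; rewrite /kd !scaler_sumr.
  apply: eq_big => [k|k]; rewrite ?inE negb_or; first by rewrite andbC eq_sym.
  move=> _; rewrite /f !scalerA; congr (_ *: _).
  by rewrite -!mulrA; congr (_ * _); rewrite !mulrA; congr (_ * _); rewrite mulrC.
(* The pairs with j < k cancel against the reversed ones, by the antisymmetry [fE]. *)
have -> : \sum_(j | j \notin A) \sum_(k | (k \notin A) && (j != k)) f j k
   = \sum_(j | j \notin A) \sum_(k | (k \notin A) && (j < k)%N) f j k
   + \sum_(j | j \notin A) \sum_(k | (k \notin A) && (k < j)%N) f j k.
  rewrite -big_split; apply: eq_bigr => j jA /=.
  rewrite (bigID (fun k : 'I_n => (j < k)%N)) /=; congr (_ + _); apply: eq_bigl => k.
    rewrite -andbA; congr (_ && _); rewrite andbC; case: ltnP => //= jk.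
    by apply/eqP => e; rewrite e ltnn in jk.
  by rewrite -leqNgt -andbA; congr (_ && _);
    rewrite [RHS]ltn_neqAle (inj_eq val_inj) eq_sym.
rewrite [X in _ + X](exchange_big_dep (fun k => k \notin A)) /=; last first.
  by move=> j k _ /andP[].
rewrite -big_split big1 //= => j jA.
rewrite [X in _ + X](eq_bigl (fun k => (k \notin A) && (j < k)%N)); last first.
  by move=> k; rewrite jA.
rewrite -big_split big1 //= => k /andP[kA jk]; rewrite fE ?addNr //.
by apply/eqP => e; rewrite e ltnn in jk.
Qed.

(* [contraction k phi] is the usual null homotopy of multiplication by 'X_k when
   phi = id, and contracts the factor of 'X_k when phi divides by 'X_k. *)
Definition contraction (k : 'I_n) (phi : 'rV[S]_g -> 'rV[S]_g) z : chain :=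
  fun A => if k \in A then (-1) ^+ below k (A :\ k) *: phi (z (A :\ k)) else 0.

(** Only the variable 'X_k contributes: if [k] is in A, every other one occurs twice with opposite
    signs by [sign_swapU]; if not, it leads to a set without [k], where the contraction is 0. *)
Lemma kd_contraction k (phi : {additive 'rV[S]_g -> 'rV[S]_g}) z A :
  (forall j v, j != k -> phi ('X_j *: v) = 'X_j *: phi v) ->
  kd (contraction k phi z) A + contraction k phi (kd z) A =
    if k \in A then phi ('X_k *: z A) else 'X_k *: phi (z A).
Proof.
move=> hphi; rewrite /contraction; case: ifPn => kA; last first.
  rewrite addr0 /kd (bigD1 k) //= big1 ?addr0 => [|j /andP[jA jk]].
    rewrite setU11 setU1K // !scalerA mulrC mulrA -signr_odd -exprD addnn.
    by rewrite -signr_odd odd_double mul1r.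
  by rewrite !inE (negbTE kA) orbF eq_sym (negbTE jk) !scaler0.
have [B kB ->] : exists2 B : {set 'I_n}, k \notin B & A = k |: B.
  by exists (A :\ k); rewrite ?setD1K // setD11.
rewrite setU1K // /kd raddf_sum /= scaler_sumr.
rewrite [X in _ + X](bigD1 k) //= addrCA [X in _ + X](_ : _ = 0) ?addr0; last first.
  rewrite (eq_bigl (fun j => (j \notin B) && (j != k))); last first.
    by move=> j; rewrite !inE negb_or andbC.
  rewrite -big_split big1 //= => j /andP[jB jk].
  have -> : (j |: (k |: B)) :\ k = j |: B.
    by rewrite setUCA setU1K // !inE negb_or eq_sym jk.
  rewrite !inE eqxx orbT (raddfZsign phi) hphi // !scalerA -scalerDl.
  rewrite (_ : _ + _ = 0) ?scale0r //.
  by rewrite mulrAC sign_swapU // 1?eq_sym //; ring.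
by rewrite (raddfZsign phi) scalerA -expr2 sqrr_sign scale1r.
Qed.

End Koszul.

(** * Division by a variable *)

Section DivX.

Variables (K : fieldType) (n : nat).
Local Notation S := {mpoly K[n]}.

(** The quotient by 'X_k, discarding the monomials without 'X_k. The bound on m only makes the sum
    finite. *)
Definition divX (k : 'I_n) (p : S) : S :=
  \sum_(m : 'X_{1..n < msize p}) p@_(m + U_(k)) *: 'X_[m].

Lemma mcoeff_divX k p m : (divX k p)@_m = p@_(m + U_(k)).
Proof.
case: (ltnP (mdeg m) (msize p)) => h.
  exact: (mcoeff_mpoly (fun m' => p@_(m' + U_(k))) h).
rewrite [RHS](_ : _ = 0); last first.
  by apply/eqP; rewrite mcoeff_eq0 msize_mdeg_ge // mdegD (leq_trans h) ?leq_addr.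
rewrite raddf_sum big1 // => m' _ /=; rewrite mcoeffZ mcoeffX.
case: eqP => [e|]; last by rewrite mulr0.
by move: (bmdeg m'); rewrite e ltnNge h.
Qed.

Lemma divX_is_additive k : additive (divX k).
Proof. by move=> p q; apply/mpolyP => m; rewrite !(mcoeffB, mcoeff_divX). Qed.

HB.instance Definition _ k :=
  GRing.isZmodMorphism.Build _ _ (divX k) (@divX_is_additive k).

Lemma divX_mulX (k : 'I_n) p : divX k ('X_k * p) = p.
Proof.
apply/mpolyP => m; rewrite mcoeff_divX mcoeff_mulX mnmDE mnm1E eqxx addn1 /=.
by congr (p@__); apply/mnmP => i; rewrite mnmBE mnmDE addnK.
Qed.

Lemma divX_mulXC (j k : 'I_n) p : j != k -> divX k ('X_j * p) = 'X_j * divX k p.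
Proof.
move=> jk; apply/mpolyP => m; rewrite mcoeff_divX !mcoeff_mulX mcoeff_divX.
rewrite mnmDE mnm1E eq_sym (negbTE jk) addn0; case: ifP => // mj.
congr (p@__); apply/mnmP => i; rewrite !(mnmBE, mnmDE, mnm1E).
case: (eqVneq j i) => [<-|_]; last by rewrite !subn0.
by rewrite eq_sym (negbTE jk) !addn0.
Qed.

End DivX.

(** * Acyclicity of the Koszul complex of a free module *)

Section KoszulExact.

Variables (K : fieldType) (n g : nat).
Local Notation S := {mpoly K[n]}.
Local Notation chain := ({set 'I_n} -> 'rV[S]_g).
Implicit Types (z w : chain) (A : {set 'I_n}).

Definition no_constant (v : 'rV[S]_g) : Prop := forall l, (v 0 l)@_0%MM = 0.

Lemma no_constant_kd w A : no_constant (kd w A).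
Proof.
move=> l; rewrite /kd summxE raddf_sum big1 //= => j _.
by rewrite !mxE mulrCA mcoeff_mulX mnm0E.
Qed.

(** The variables are eliminated one by one: contracting with [divX k] changes the cycle by a
    boundary until no set contains [k] and no monomial involves 'X_k. Only a constant at the empty
    set could survive, and it is excluded. *)
Lemma kd_exact z : (forall A, kd z A = 0) -> no_constant (z set0) ->
  exists w, forall A, z A = kd w A.
Proof.
move=> hz h0.
(* Invariant: what remains of [z] avoids the first c variables, both in the sets A and in the
   monomials. *)
have : forall c, (c <= n)%N -> exists w, forall A,
    (forall k : 'I_n, (k < c)%N -> k \in A -> z A - kd w A = 0) /\
    (forall (k : 'I_n) l (m : 'X_{1..n}), (k < c)%N -> (0 < m k)%N ->
       ((z A - kd w A) 0 l)@_m = 0).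
  elim=> [|c IH] cn; first by exists (fun _ => 0).
  have [w hw] := IH (ltnW cn); pose k := Ordinal cn.
  pose z' : chain := fun A => z A - kd w A.
  pose phi : {additive 'rV[S]_g -> 'rV[S]_g} := map_mx (divX k).
  have phiC j v : j != k -> phi ('X_j *: v) = 'X_j *: phi v.
    by move=> jk; apply/rowP => l; rewrite !mxE /= divX_mulXC.
  have hz' A : kd z' A = 0 by rewrite kd_sub hz kd_kd subr0.
  exists (fun A => w A + contraction k phi z' A) => A.
  have -> : z A - kd (fun A => w A + contraction k phi z' A) A
    = z' A - (if k \in A then phi ('X_k *: z' A) else 'X_k *: phi (z' A)).
    have c0 : contraction k phi (kd z') A = 0.
      by rewrite /contraction; case: ifP; rewrite ?hz' ?raddf0 ?scaler0.
    by rewrite -kd_contraction // c0 addr0 kd_add opprD addrA.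
  have e1 : k \in A -> z' A - phi ('X_k *: z' A) = 0.
    by move=> _; apply/rowP => l; rewrite !mxE /= divX_mulX subrr.
  have [hw1 hw2] := hw A; split=> [i | i l m]; rewrite ltnS leq_eqVlt.
    case: ifPn => [/e1 //|kA] /orP[/eqP ic|ic] iA.
      by case/negP: kA; rewrite (_ : k = i) //; apply: val_inj.
    have z'A : z' A = 0 by exact: hw1 iA.
    by rewrite z'A raddf0 scaler0 subr0.
  move=> hi hm; case: ifPn => [/e1 ->|kA]; first by rewrite mxE mcoeff0.
  rewrite !mxE /= mcoeffB mcoeff_mulX mcoeff_divX.
  case: (posnP (m k)) => [mk|mk].
    rewrite subr0; case/orP: hi => [/eqP ic|ic].
      by move: mk; rewrite (_ : k = i) => [e|]; [rewrite e in hm | apply: val_inj].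
    by have := hw2 i l m ic hm; rewrite !mxE.
  suff -> : (m - U_(k) + U_(k))%MM = m by rewrite subrr.
  apply/mnmP => x; rewrite mnmDE mnmBE mnm1E subnK //.
  by case: eqP => [<-|].
case/(_ n (leqnn n)) => w hw; exists w => A; have [h1 _] := hw A.
apply/eqP; rewrite -subr_eq0; apply/eqP.
have [->|[k kA]] := set_0Vmem A; last exact: (h1 k).
apply/rowP => l; apply/mpolyP => m; rewrite [in RHS]mxE mcoeff0.
have [/eqP m0|] := boolP (mdeg m == 0%N); last first.
  rewrite mdegE sum_nat_eq0 negb_forall => /existsP[k /=]; rewrite -lt0n => mk.
  by have [_ h] := hw set0; apply: (h k).
move/eqP: m0; rewrite mdeg_eq0 => /eqP ->.
by rewrite mxE mcoeffD h0 mxE mcoeffN no_constant_kd subr0.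
Qed.

(** The total degree is kept while one basis vector of degree 1 is lost, so the coefficients gain
    one degree. *)
Lemma hproj_kd (a : 'I_g -> nat) e w A :
  hproj a e.+1 (kd w A) = kd (fun B => hproj a e (w B)) A.
Proof.
rewrite raddf_sum; apply: eq_bigr => j _; rewrite /= (raddfZsign (hproj a e.+1)) /=.
have hX : ('X_j : S) \is 1.-homog by rewrite dhomogX; apply/eqP/mdeg1.
by rewrite (hprojZ _ _ _ hX) subn1.
Qed.

Lemma kd_exact_hom (a : 'I_g -> nat) e q z :
  (forall A, #|A| != q -> z A = 0) -> (forall A, vhom a e.+1 (z A)) ->
  (forall A, kd z A = 0) -> no_constant (z set0) ->
  exists w, [/\ forall A, #|A| != q.+1 -> w A = 0, forall A, vhom a e (w A)
              & forall A, z A = kd w A].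
Proof.
move=> hq hom hz h0; have [w hw] := kd_exact hz h0.
exists (fun A => if #|A| == q.+1 then hproj a e (w A) else 0); split=> A.
- by move/negbTE ->.
- by case: ifP => _; [exact: vhom_hproj | rewrite /vhom raddf0].
case: (eqVneq #|A| q) => [e'|ne].
  rewrite -hom hw hproj_kd; apply: eq_bigr => j jA.
  by rewrite cardsU1 jA e' eqxx.
rewrite hq // /kd big1 // => j jA.
by rewrite cardsU1 jA eqSS (negbTE ne) !scaler0.
Qed.

End KoszulExact.

(** * Koszul homology of graded submodules *)

Section Submodules.

Variables (K : fieldType) (n g : nat).
Local Notation S := {mpoly K[n]}.
Implicit Types (N : 'rV[S]_g -> Prop) (a : 'I_g -> nat).

Definition submodule N : Prop :=
  [/\ N 0, forall u v, N u -> N v -> N (u + v) & forall c u, N u -> N (c *: u)].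

Definition graded a N : Prop := forall d v, N v -> N (hproj a d v).

Lemma submodule_sum N I (r : seq I) (P : pred I) (F : I -> 'rV[S]_g) :
  submodule N -> (forall i, P i -> N (F i)) -> N (\sum_(i <- r | P i) F i).
Proof. by case=> h0 hD _ hF; apply: big_ind. Qed.

Lemma submodule_kd N w A : submodule N -> (forall B, N (w B)) -> N (@kd K n g w A).
Proof.
move=> hN hw; apply: submodule_sum => // j _; case: hN => _ _ hZ.
by apply: (hZ); apply: hZ.
Qed.

Lemma submodule_sub N u v : submodule N -> N u -> N v -> N (u - v).
Proof.
by case=> _ hD hZ hu hv; apply: hD => //; rewrite -scaleN1r; apply: hZ.
Qed.

(* Here and below a class of H_q(N) is measured by the degree of its coefficients,
   which is its total degree minus q. *)
Definition koszul_vanishes a N q rho : Prop :=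
  forall e z, (rho < e)%N -> (forall A, N (z A)) ->
    (forall A : {set 'I_n}, #|A| != q -> z A = 0) ->
    (forall A, vhom a e (z A)) -> (forall A, kd z A = 0) ->
  exists w, (forall A, N (w A)) /\ forall A, z A = kd w A.

Definition koszul_nonzero a N q e : Prop :=
  exists z, [/\ forall A, N (z A), forall A : {set 'I_n}, #|A| != q -> z A = 0,
    forall A, vhom a e (z A), forall A, kd z A = 0 &
    forall w, (forall A, N (w A)) -> ~ (forall A, z A = kd w A)].

(** Homogeneous generators of N; the last clause puts the relations among them inside m times the
    free module, which is minimality. *)
Definition cover a N g' (a' : 'I_g' -> nat) (B : 'M[S]_(g', g)) : Prop :=
  [/\ forall k, vhom a (a' k) (row k B),
      forall v, N v <-> exists w, v = w *m B
    & forall w, w *m B = 0 -> no_constant w].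

End Submodules.

(** * Dimension shift along a minimal cover *)

Section Shift.

Variables (K : fieldType) (n g g' : nat).
Local Notation S := {mpoly K[n]}.
Variables (a : 'I_g -> nat) (N : 'rV[S]_g -> Prop).
Variables (a' : 'I_g' -> nat) (B : 'M[S]_(g', g)).
Hypothesis cov : cover a N a' B.

Definition kernel (w : 'rV[S]_g') : Prop := w *m B = 0.

Lemma submodule_kernel : submodule kernel.
Proof.
split; first exact: mul0mx.
- by move=> u v hu hv; rewrite /kernel mulmxDl hu hv addr0.
by move=> c u hu; rewrite /kernel -scalemxAl hu scaler0.
Qed.

Lemma graded_kernel : graded a' kernel.
Proof.
case: cov => hB _ _ d v hv; rewrite /kernel -(hproj_mul d v hB).
by rewrite hv raddf0.
Qed.

Lemma kd_mulmx (z : {set 'I_n} -> 'rV[S]_g') A :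
  kd (fun C => z C *m B) A = kd z A *m B.
Proof. by rewrite /kd mulmx_suml; apply: eq_bigr => j _; rewrite -!scalemxAl. Qed.

Lemma cover_lift (z : {set 'I_n} -> 'rV[S]_g) : (forall A, N (z A)) ->
  exists w, forall A, z A = w A *m B.
Proof.
move=> hz; apply: (classical_choice (P := fun A w => z A = w *m B)) => A.
by case: cov => _ hN _; apply/hN.
Qed.

(** A cycle [z] of the kernel bounds some [y] in the free module, since minimality excludes
    constants. The image of [y] is a cycle of N, hence bounds; lifting its primitive corrects [y]
    into the kernel without changing its boundary. *)
Lemma koszul_vanishes_kernel q rho :
  koszul_vanishes a N q.+1 rho -> koszul_vanishes a' kernel q rho.+1.
Proof.
case: cov => hB hN hmin hv [//|e] z he hz hq hom hz0.
have [y [yq yhom yz]] := kd_exact_hom hq hom hz0 (hmin _ (hz set0)).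
have yB A : N (y A *m B) by apply/hN; exists (y A).
have [A||A|w [wN hw]] := hv e (fun A => y A *m B) he yB.
- by move=> /yq ->; rewrite mul0mx.
- by move=> A; rewrite /vhom (hproj_mul e _ hB) yhom.
- by rewrite kd_mulmx -yz; apply: hz.
have [w' hw'] := cover_lift wN.
exists (fun A => y A - kd w' A); split=> A.
  rewrite /kernel mulmxBl hw -kd_mulmx; apply/eqP; rewrite subr_eq0; apply/eqP.
  by apply: eq_kd.
by rewrite kd_sub kd_kd subr0.
Qed.

(** The connecting map in the other direction: a cycle of N is lifted to [y'] and yields [kd y']. If
    that were a boundary from the kernel, exactness in the free module would make the given cycle a
    boundary in N. *)
Lemma koszul_nonzero_kernel q e :
  koszul_nonzero a N q.+1 e -> koszul_nonzero a' kernel q e.+1.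
Proof.
case: cov => hB hN hmin [y [yN yq yhom y0 yw]].
have [y1 hy1] := cover_lift yN.
pose y' (A : {set 'I_n}) := if #|A| == q.+1 then hproj a' e (y1 A) else 0.
have y'B A : y A = y' A *m B.
  rewrite /y'; case: eqP => [_|/eqP /yq ->]; last by rewrite mul0mx.
  by rewrite -(hproj_mul e _ hB) -hy1 yhom.
exists (kd y'); split.
- by move=> A; rewrite /kernel -kd_mulmx -(eq_kd (z := y)) ?y0.
- move=> A hA; rewrite /kd big1 // => j jA.
  by rewrite /y' cardsU1 jA eqSS (negbTE hA) !scaler0.
- move=> A; rewrite /vhom hproj_kd; apply: eq_kd => C.
  by rewrite /y'; case: ifP => _; rewrite ?raddf0 // vhom_hproj.
- exact: kd_kd.
move=> w wN hw.
have [|l|u hu] := @kd_exact _ _ _ (fun A => y' A - w A).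
- by move=> A; rewrite kd_sub hw subrr.
(* [y'] lives on sets of positive size q + 1, and [w] has no constants by minimality. *)
- have e0 : y' set0 = 0 by rewrite /y' cards0.
  by rewrite e0 mxE mxE mcoeffD mcoeff0 mxE mcoeffN (hmin _ (wN _)) subr0.
apply: (yw (fun A => u A *m B)) => A; first by apply/hN; exists (u A).
by rewrite kd_mulmx -hu mulmxBl wN subr0.
Qed.

(** H_0(N) is N / mN: without a generator in degree [e], the coefficients of an element of that
    degree have no constants, so the element is a boundary. *)
Lemma cover_shift_of_nonzero e : koszul_nonzero a N 0 e -> exists k, a' k = e.
Proof.
case: cov => hB hN hmin [z [zN zq zhom z0 zw]].
apply: NNPP => ne; have [u hu] := (hN _).1 (zN set0).
have hu' : z set0 = hproj a' e u *m B by rewrite -(hproj_mul e _ hB) -hu zhom.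
pose z' (A : {set 'I_n}) := if A == set0 then hproj a' e u else 0.
have jA0 (j : 'I_n) A : j |: A == set0 = false.
  by apply/negbTE/set0Pn; exists j; rewrite setU11.
have [A|l|y hy] := @kd_exact _ _ _ z'.
- by rewrite /kd big1 // => j _; rewrite /z' jA0 !scaler0.
- rewrite /z' eqxx mxE; case: ifP => he; last by rewrite mcoeff0.
  (* A constant in the degree [e] part of coordinate [l] would force [a' l = e]. *)
  rewrite mcoeff_pihomog mdeg0 eq_sym subn_eq0; case: ifP => // he'.
  by case: ne; exists l; apply/eqP; rewrite eqn_leq he he'.
apply: (zw (fun A => y A *m B)) => A; first by apply/hN; exists (y A).
rewrite kd_mulmx -hy /z'; case: eqP => [->//|/eqP hA].
by rewrite mul0mx zq // cards_eq0.
Qed.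

End Shift.

(** * Existence of minimal covers *)

Lemma exists_minimal_nat (P : nat -> Prop) :
  (exists m, P m) -> exists m, P m /\ forall m', (m' < m)%N -> ~ P m'.
Proof.
case=> m; elim/ltn_ind: m => m IH Pm.
have [[m' [lt Pm']]|no] := classic (exists m', (m' < m)%N /\ P m').
  exact: IH lt Pm'.
by exists m; split=> // m' lt Pm'; apply: no; exists m'.
Qed.

(** A sequence in [P] whose span has minimal codimension works: a vector of [P] outside the span
    would lower the codimension. *)
Lemma exists_spanning_seq (K : fieldType) (V : vectType K) (P : V -> Prop) :
  exists X : seq V, (forall x, x \in X -> P x) /\ (forall v, P v -> v \in <<X>>%VS).
Proof.
pose Q m := exists X : seq V, (forall x, x \in X -> P x) /\
  (\dim {:V} - \dim <<X>>)%N = m.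
have [|m [[X [XP Xm]] mmin]] := @exists_minimal_nat Q.
  by exists (\dim {:V} - \dim <<Nil V>>)%N, [::].
exists X; split=> // v Pv; apply: NNPP => /negP vX.
have sub : (<<X>> <= <<v :: X>>)%VS by rewrite span_cons addvSr.
have lt : (\dim <<X>> < \dim <<v :: X>>)%N.
  rewrite ltnNge; apply: contraNN vX => le.
  have /eqP -> : (<<X>> == <<v :: X>>)%VS by rewrite eqEdim sub.
  by rewrite memv_span ?mem_head.
apply: (mmin (\dim {:V} - \dim <<v :: X>>)%N); last first.
  by exists (v :: X); split=> // x; rewrite inE => /orP[/eqP ->|/XP].
by rewrite -Xm ltn_sub2l // (leq_trans lt) // dimvS ?subvf.
Qed.

Section Cover.

Variables (K : fieldType) (n g : nat).
Local Notation S := {mpoly K[n]}.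
Variables (a : 'I_g -> nat) (N : 'rV[S]_g -> Prop).
Hypotheses (Nsub : submodule N) (Ngr : graded a N).

Definition hom_generators rho g' (a' : 'I_g' -> nat) (B : 'M[S]_(g', g)) : Prop :=
  [/\ forall k, vhom a (a' k) (row k B), forall k, (a' k <= rho)%N
    & forall v, N v <-> exists w, v = w *m B].

Lemma submodule_image g' (B : 'M[S]_(g', g)) : submodule (fun v => exists w, v = w *m B).
Proof.
split; first by exists 0; rewrite mul0mx.
- by move=> _ _ [u ->] [v ->]; exists (u + v); rewrite mulmxDl.
by move=> c _ [u ->]; exists (c *: u); rewrite scalemxAl.
Qed.

(** Shifts are natural numbers, so an element of degree [d] is given by its coefficients on
    monomials of degree at most [d]. This is a finite-dimensional space, in which finitely many
    elements span the degree [d] part of N. *)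
Lemma graded_piece_span d : exists L : seq 'rV[S]_g,
  (forall x, x \in L -> N x /\ vhom a d x) /\
  forall M, submodule M -> (forall x, x \in L -> M x) ->
    forall v, N v -> vhom a d v -> M v.
Proof.
pose V : vectType K := {ffun 'I_g * 'X_{1..n < d.+1} -> K^o}.
pose build (c : V) : 'rV[S]_g := \row_k \sum_(m : 'X_{1..n < d.+1}) c (k, m) *: 'X_[m].
have buildZ x c : build (x *: c) = x%:MP *: build c.
  apply/rowP => k; rewrite !mxE mulr_sumr; apply: eq_bigr => m _.
  by rewrite ffunE mul_mpolyC scalerA.
have buildD x y : build (x + y) = build x + build y.
  apply/rowP => k; rewrite !mxE -big_split; apply: eq_bigr => m _.
  by rewrite ffunE scalerDl.
have build0 : build 0 = 0 by rewrite -(scale0r 0) buildZ mpolyC0 scale0r.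
have [X [XP Xspan]] :=
  @exists_spanning_seq K V (fun c => N (build c) /\ vhom a d (build c)).
exists [seq build c | c <- X]; split=> [_ /mapP[c /XP cP ->] //|M Msub XM v Nv hv].
pose c : V := [ffun km : 'I_g * 'X_{1..n < d.+1} => (v 0 km.1)@_km.2].
have vE : v = build c.
  apply/rowP => k; rewrite mxE {1}(@mpolywE _ _ d.+1 (v 0 k)).
    by apply: eq_bigr => m _; rewrite ffunE.
  rewrite msizeE; apply/bigmax_leqP_seq => m ms _; rewrite ltnS.
  move/vhomP/(_ k): hv; case: ifP => h; last by move=> e; rewrite e msupp0 in ms.
  by move/dhomogP/(_ _ ms) => /= ->; rewrite leq_subr.
have cX : c \in <<in_tuple X>>%VS by apply: Xspan; rewrite -vE.
rewrite vE (coord_span cX); case: (Msub) => M0 MD MZ.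
elim/big_ind: _ => [|x y hx hy|i _]; first by rewrite build0.
  by rewrite buildD; apply: MD.
by rewrite buildZ; apply/MZ/XM/map_f; rewrite mem_nth.
Qed.

(** Generators of the pieces up to [rho] suffice: above [rho] the vanishing of H_0 writes an element
    as a combination of variables times elements of N of one degree less. *)
Lemma exists_hom_generators rho : koszul_vanishes a N 0 rho ->
  exists g' a' (B : 'M[S]_(g', g)), hom_generators rho a' B.
Proof.
move=> van; have [L hL] := classical_choice graded_piece_span.
pose L' := flatten [seq [seq (d, x) | x <- L d] | d <- iota 0 rho.+1].
have L'P e : e \in L' -> [/\ N e.2, vhom a e.1 e.2 & (e.1 <= rho)%N].
  case/flattenP => _ /mapP[d hd ->] /mapP[x xL ->] /=.
  have [h _] := hL d; have [h1 h2] := h x xL; split=> //.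
  by move: hd; rewrite mem_iota ltnS.
pose B := \matrix_(i < size L') (nth (0%N, 0) L' i).2.
exists (size L'), (fun i => (nth (0%N, 0) L' i).1), B.
have L'n (k : 'I_(size L')) := L'P _ (mem_nth (0%N, 0) (ltn_ord k)).
split=> [k|k|v].
- by rewrite rowK; case: (L'n k).
- by case: (L'n k).
split; last first.
  case=> w ->; rewrite mulmx_sum_row; apply: submodule_sum => // k _.
  by case: Nsub => _ _; apply; rewrite rowK; case: (L'n k).
have Msub := submodule_image B; set M := (fun v => _) in Msub.
have ML' d x : (d <= rho)%N -> x \in L d -> M x.
  move=> hd xL; have dx : (d, x) \in L'.
    apply/flattenP; exists [seq (d, x) | x <- L d]; last exact: map_f.
    by apply: (map_f (fun d => [seq (d, x) | x <- L d])); rewrite mem_iota ltnS.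
  have hi : (index (d, x) L' < size L')%N by rewrite index_mem.
  exists (delta_mx 0 (Ordinal hi)); rewrite -rowE rowK /= nth_index //.
move=> Nv; have [D ->] := hproj_sum_all a v.
apply: (submodule_sum (N := M)) => // d _; move: (nat_of_ord d) => {D}d.
have : vhom a d (hproj a d v) by exact: vhom_hproj.
have : N (hproj a d v) by exact: Ngr.
elim: d (hproj a d v) => [|d IH] {Nv}v Nv hv.
  by have [_ h] := hL 0%N; apply: h hv => // x; apply: ML'.
case: (leqP d.+1 rho) => hd.
  by have [_ h] := hL d.+1; apply: h hv => // x; apply: ML'.
(* The element is a cycle concentrated at the empty set. *)
pose z (A : {set 'I_n}) := if A == set0 then v else 0.
have jA0 (j : 'I_n) A : j |: A == set0 = false.
  by apply/negbTE/set0Pn; exists j; rewrite setU11.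
have [A|A|A|A|w [wN hw]] := van d.+1 z hd.
- by rewrite /z; case: ifP => // _; case: Nsub.
- by rewrite cards_eq0 /z => /negbTE ->.
- by rewrite /z; case: ifP => // _; rewrite /vhom raddf0.
- by rewrite /kd big1 // => j _; rewrite /z jA0 !scaler0.
have e : v = kd w set0 by rewrite -hw /z eqxx.
rewrite -hv e hproj_kd.
apply: submodule_kd => // A; apply: IH; last exact: vhom_hproj.
by apply: Ngr.
Qed.

(** A relation with a nonzero constant at [l] can be solved for the generator [l]. *)
Lemma drop_generator rho g' (a' : 'I_g'.+1 -> nat) (B : 'M[S]_(g'.+1, g))
    (w : 'rV[S]_g'.+1) l :
  hom_generators rho a' B -> w *m B = 0 -> (w 0 l)@_0%MM != 0 ->
  hom_generators rho (fun k => a' (lift l k)) (row' l B).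
Proof.
case=> hB hle hN wB w0; set c := (w 0 l)@_0%MM in w0.
(* In degree [a' l] the coefficient at [l] reduces to its constant, which is invertible. *)
pose w' := hproj a' (a' l) w.
have w'B : w' *m B = 0 by rewrite -(hproj_mul _ _ hB) wB raddf0.
have rowE' k : row k (row' l B) = row (lift l k) B by apply/rowP => j; rewrite !mxE.
have split_sum (u : 'rV[S]_g'.+1) :
  u *m B = u 0 l *: row l B + (\row_k u 0 (lift l k)) *m row' l B.
  rewrite mulmx_sum_row (bigD1_ord l) // [X in _ = _ + X]mulmx_sum_row; congr (_ + _).
  by apply: eq_bigr => k _; rewrite rowE' mxE.
have w'l : w' 0 l = c%:MP.
  rewrite mxE leqnn subnn; apply/mpolyP => m.
  by rewrite mcoeff_pihomog mdeg_eq0 mcoeffC; case: eqP => [->|_]; rewrite ?mulr1 ?mulr0.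
have rowl : row l B = ((- c^-1)%:MP *: \row_k w' 0 (lift l k)) *m row' l B.
  have := split_sum w'; rewrite w'B w'l => /esym/eqP; rewrite addrC addr_eq0 => /eqP e.
  rewrite -scalemxAl e scalerN scalerA -mpolyCM mulNr mulVf // mpolyCN mpolyC1.
  by rewrite scaleN1r opprK.
split=> [k|k|v]; rewrite ?rowE' //.
rewrite hN; split=> [[u ->]|[u ->]].
  rewrite split_sum rowl scalemxAl -mulmxDl; by eexists.
exists (\row_k if unlift l k is Some k' then u 0 k' else 0).
rewrite split_sum mxE unlift_none scale0r add0r; congr (_ *m _).
by apply/rowP => k; rewrite !mxE liftK.
Qed.

(** The number of generators is taken minimal; a relation violating minimality of the cover would
    allow one to be dropped. *)
Lemma exists_cover rho : koszul_vanishes a N 0 rho ->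
  exists g' a' (B : 'M[S]_(g', g)), cover a N a' B /\ forall k, (a' k <= rho)%N.
Proof.
move/exists_hom_generators/exists_minimal_nat => [g' [[a' [B hB]] gmin]].
exists g', a', B; case: (hB) => h1 h2 h3; split=> //; split=> // w wB l.
apply: NNPP => /eqP w0; case: g' a' B w l hB wB w0 gmin {h1 h2 h3} => [|g'] a' B w l.
  by case: l.
move=> hB wB w0 gmin; apply: (gmin g') => //.
by have h := drop_generator hB wB w0; do 2!eexists; exact: h.
Qed.

End Cover.

(** * Regularity of an ideal with a nonzerodivisor *)

Section IdealRegularity.

Variables (K : fieldType) (n : nat).
Local Notation S := {mpoly K[n]}.
Variables (I : S -> Prop) (t : 'I_n) (r : nat).
Hypotheses (n2 : (1 < n)%N).
Hypotheses (I0 : I 0) (ID : forall p q, I p -> I q -> I (p + q))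
  (IM : forall p q, I q -> I (p * q)) (Igr : forall d p, I p -> I (pihomog mdeg d p)).
Hypothesis Ireg : forall p, I ('X_t * p) -> I p.
Hypothesis Ihigh : forall d p, (r <= d)%N -> p \is d.-homog -> exists s, I (p - 'X_t * s).
Hypothesis Itop :
  exists d p, [/\ r = d.+1, p \is d.-homog & forall s, ~ I (p - 'X_t * s)].

Definition ideal_rows (v : 'rV[S]_1) : Prop := I (v 0 0).
Definition unit_shift (_ : 'I_1) : nat := 0%N.

Lemma submodule_ideal : submodule ideal_rows.
Proof.
split; rewrite /ideal_rows; first by rewrite mxE.
- by move=> u v hu hv; rewrite mxE; apply: ID.
by move=> c u hu; rewrite mxE; apply: IM.
Qed.

Lemma graded_ideal : graded unit_shift ideal_rows.
Proof. by move=> d v hv; rewrite /ideal_rows mxE /= subn0; apply: Igr. Qed.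

(** I is proper: a nonzero constant would put a unit into I, and with it the witness of [Itop]. *)
Lemma ideal_no_constant v : ideal_rows v -> no_constant v.
Proof.
move=> hv l; rewrite (ord1 l); apply: NNPP => /eqP c0.
have [d [p [_ _ hp]]] := Itop; apply: (hp 0); rewrite mulr0 subr0.
have -> : p = (p * ((v 0 0)@_0%MM)^-1%:MP) * pihomog mdeg 0 (v 0 0).
  rewrite -mulrA [X in p * X](_ : _ = 1) ?mulr1 //.
  apply/mpolyP => m; rewrite mcoeffCM mcoeff_pihomog mdeg_eq0 mcoeff1.
  by case: eqP => [->|_]; rewrite ?mulVf ?mulr0.
by apply: IM; apply: Igr.
Qed.

Lemma vhom_unit_shift d (v : 'rV[S]_1) : vhom unit_shift d v <-> v 0 0 \is d.-homog.
Proof.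
split=> [/vhomP/(_ 0) /=|h]; first by rewrite subn0.
by apply/vhomP => k; rewrite (ord1 k) /= subn0.
Qed.

Lemma ideal_reg_row v : ideal_rows ('X_t *: v) -> ideal_rows v.
Proof. by rewrite /ideal_rows mxE; apply: Ireg. Qed.

Lemma ideal_high_row d v : (r <= d)%N -> vhom unit_shift d v ->
  exists s, ideal_rows (v - 'X_t *: s).
Proof.
move=> rd /vhom_unit_shift hv; have [s hs] := Ihigh rd hv.
by exists (const_mx s); rewrite /ideal_rows !mxE.
Qed.

(* Above degree r every chain is divisible by 'X_t modulo I, and the contraction of
   the factor 'X_t turns this into a boundary. *)
Lemma koszul_vanishes_ideal q : koszul_vanishes unit_shift ideal_rows q r.
Proof.
move=> [//|e] z re zN zq zhom z0.
have [y [_ yhom yz]] := kd_exact_hom zq zhom z0 (ideal_no_constant (zN set0)).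
have [s hs] : exists s : {set 'I_n} -> 'rV[S]_1, forall A, ideal_rows (y A - 'X_t *: s A).
  apply: (classical_choice (P := fun A v => ideal_rows (y A - 'X_t *: v))) => A.
  exact: ideal_high_row (yhom A).
pose i A := y A - 'X_t *: s A.
have ks A : z A = kd i A + 'X_t *: kd s A by rewrite kd_sub kd_scale -yz subrK.
(* 'X_t times [kd s] is [z - kd i], which lies in I, and 'X_t is a nonzerodivisor modulo I. *)
have sN A : ideal_rows (kd s A).
  apply: ideal_reg_row.
  rewrite (_ : _ *: _ = z A - kd i A); last by rewrite ks addrC addKr.
  apply: submodule_sub => //; first exact: submodule_ideal.
  by apply: submodule_kd; first exact: submodule_ideal.
exists (fun A => i A + contraction t idfun (kd s) A); split=> A.
  case: submodule_ideal => N0 ND NZ; apply: ND; first exact: hs.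
  by rewrite /contraction; case: ifP => // _; apply: NZ; apply: sN.
rewrite kd_add ks; congr (_ + _).
have := @kd_contraction _ _ _ t idfun (kd s) A (fun _ _ _ => erefl).
rewrite /= if_same => <-; rewrite [X in _ + X](_ : _ = 0) ?addr0 //.
by rewrite /contraction kd_kd scaler0; case: ifP.
Qed.

Lemma kd_setC1 g (w : {set 'I_n} -> 'rV[S]_g) :
  kd w (~: [set t]) = (-1) ^+ below t (~: [set t]) *: ('X_t *: w setT).
Proof.
rewrite /kd (big_pred1 t) => [|j]; last by rewrite !inE negbK.
by congr (_ *: (_ *: w _)); apply/setP => j; rewrite !inE orbN.
Qed.

(** With p on the full set as chain [f], [kd f] has degree r, so it equals 'X_t times some [y]
    modulo I. Applying the differential and cancelling 'X_t shows that [kd y] has values in I; this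
    is the class. *)
Lemma koszul_nonzero_ideal : koszul_nonzero unit_shift ideal_rows n.-2 r.
Proof.
have [d [p [rd hp pN]]] := Itop.
pose f (A : {set 'I_n}) : 'rV[S]_1 := if A == setT then const_mx p else 0.
have fhom A : vhom unit_shift d (f A).
  apply/vhom_unit_shift; rewrite /f; case: ifP; rewrite mxE // => _; exact: rpred0.
have kfhom A : vhom unit_shift r (kd f A).
  by rewrite rd /vhom hproj_kd; apply: eq_kd.
have [y0 hy0] : exists s : {set 'I_n} -> 'rV[S]_1,
    forall A, ideal_rows (kd f A - 'X_t *: s A).
  apply: (classical_choice (P := fun A v => ideal_rows (kd f A - 'X_t *: v))) => A.
  exact: ideal_high_row (kfhom A).
have [nsub ngr] := (submodule_ideal, graded_ideal); have [N0 ND NZ] := nsub.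
(* Truncation to sets of size n - 1 and degree d makes [y] homogeneous and keeps the congruence. *)
pose y (A : {set 'I_n}) := if #|A| == n.-1 then hproj unit_shift d (y0 A) else 0.
have yN A : ideal_rows (kd f A - 'X_t *: y A).
  rewrite /y; case: ifPn => hA.
    have := ngr r _ (hy0 A); rewrite raddfB /= kfhom.
    have hX : ('X_t : S) \is 1.-homog by rewrite dhomogX; apply/eqP/mdeg1.
    by rewrite (hprojZ _ _ _ hX) rd subn1.
  rewrite scaler0 subr0 /kd big1 // => j jA; rewrite /f.
  case: eqP; rewrite ?scaler0 // => e.
  case/eqP: hA; move: (cardsU1 j A); rewrite e jA cardsT card_ord add1n.
  by move/(congr1 predn)/esym.
exists (kd y); split.
- move=> A; apply: ideal_reg_row; rewrite -kd_scale.
  rewrite (_ : kd _ A = - kd (fun C => kd f C - 'X_t *: y C) A).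
    by rewrite -scaleN1r; apply: NZ; apply: submodule_kd.
  by rewrite kd_sub kd_kd sub0r opprK.
- move=> A hA; rewrite /kd big1 // => j jA; rewrite /y cardsU1 jA add1n.
  case: eqP; rewrite ?scaler0 // => e; case/eqP: hA; by rewrite -[#|A|]/(#|A|.+1.-1) e.
- move=> A; rewrite /vhom rd hproj_kd; apply: eq_kd => B.
  by rewrite /y; case: ifP; rewrite ?raddf0 // vhom_hproj.
- exact: kd_kd.
move=> w wN hw.
have [|l|u hu] := @kd_exact _ _ _ (fun A => y A - w A).
- by move=> A; rewrite kd_sub hw subrr.
(* As n > 1, the empty set does not have n - 1 elements. *)
- have e0 : y set0 = 0.
    have n1 : (0 < n.-1)%N by rewrite -ltnS (ltn_predK n2).
    by rewrite /y cards0; case: eqP => // e; rewrite -e in n1.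
  by rewrite e0 sub0r mxE mcoeffN (ideal_no_constant (wN _)) oppr0.
(* On the complement of [t] a boundary is, up to sign, 'X_t times the value on the full set.
   Cancelling one 'X_t puts p into I + ('X_t), against [Itop]. *)
have := yN (~: [set t]).
have -> : y (~: [set t]) = kd u (~: [set t]) + w (~: [set t]) by rewrite -hu subrK.
rewrite !kd_setC1 /f eqxx; set s := (-1) ^+ _ => h.
have {}h : ideal_rows ('X_t *: (s *: (const_mx p - 'X_t *: u setT))).
  have := ND _ _ h (NZ 'X_t _ (wN (~: [set t]))); congr ideal_rows.
  rewrite scalerDr opprD addrA subrK scalerBr scalerBr.
  by rewrite !scalerA ['X_t * s]mulrC mulrAC.
have := NZ s _ (ideal_reg_row h); rewrite scalerA -expr2 sqrr_sign scale1r.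
by rewrite /ideal_rows !mxE; apply: pN.
Qed.

(** * Iterated syzygies *)

Record stage := Stage {
  rank : nat; degs : 'I_rank -> nat; relations : 'rV[S]_rank -> Prop }.

Record stage_cover (s : stage) := StageCover {
  crank : nat; cdegs : 'I_crank -> nat; cmap : 'M[S]_(crank, rank s) }.

(** What the dimension shift leaves at the i-th syzygy module: degree bounds raised by i, and the
    nonzero class moved down by i homological degrees, reaching H_0 at i = n - 2. *)
Definition good_stage (i : nat) (s : stage) : Prop :=
  [/\ submodule (@relations s), graded (@degs s) (@relations s),
      forall q, koszul_vanishes (@degs s) (@relations s) q (r + i)%N
    & (i <= n.-2)%N -> koszul_nonzero (@degs s) (@relations s) (n.-2 - i)%N (r + i)%N].

Definition good_cover (i : nat) (s : stage) (c : stage_cover s) : Prop :=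
  cover (@degs s) (@relations s) (@cdegs s c) (cmap c) /\
  forall k : 'I_(crank c), (cdegs k <= r + i)%N.

(** The implication is under the existential so that covers can be chosen for all stages at once; a
    bad stage gets an empty cover. *)
Lemma exists_good_cover i s : exists c : stage_cover s, good_stage i s -> good_cover i c.
Proof.
have [[h1 h2 h3 _]|ng] := classic (good_stage i s); last first.
  by exists (StageCover (fun _ : 'I_0 => 0%N) 0).
have [g' [a' [B [hc hle]]]] := exists_cover h1 h2 (h3 0%N).
by exists (StageCover a' B).
Qed.

Definition next_stage s (c : stage_cover s) : stage :=
  Stage (@cdegs s c) (kernel (cmap c)).

Lemma good_next_stage i s (c : stage_cover s) :
  good_stage i s -> good_cover i c -> good_stage i.+1 (next_stage c).
Proof.
case=> h1 h2 h3 h4 [hc _]; split.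
- exact: submodule_kernel.
- exact: graded_kernel hc.
- by move=> q; rewrite addnS; apply: (koszul_vanishes_kernel hc).
move=> hi; rewrite addnS; apply: (koszul_nonzero_kernel hc).
by rewrite subnSK //; apply: h4; apply: ltnW.
Qed.

Lemma regular_resolution : exists F : free_complex K n,
  [/\ graded_free_resolution F I, minimal_complex F,
      exists i j, betti F i j != 0%N /\ j - i%:Z = Posz r
    & forall i j, betti F i j != 0%N -> j - i%:Z <= Posz r].
Proof.
have [f hf] := classical_choice (fun x : nat * stage => exists_good_cover x.1 x.2).
pose st := fix st i := if i is j.+1 then next_stage (f (j, st j))
                       else Stage unit_shift ideal_rows.
have good i : good_stage i (st i) /\ good_cover i (f (i, st i)).
  suff h : good_stage i (st i) by split=> //; apply: (hf (i, _)) h.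
  elim: i => [|i IH]; last by apply: (good_next_stage IH); apply: (hf (i, _)) IH.
  split; [exact: submodule_ideal | exact: graded_ideal | |].
    by move=> q; rewrite addn0; apply: koszul_vanishes_ideal.
  by move=> _; rewrite addn0 subn0; apply: koszul_nonzero_ideal.
(* F_i is the source of the cover of stage i, that is, the free module containing stage i + 1. *)
pose F := @FreeComplex K n (fun i => rank (st i.+1))
  (fun i k => Posz (@degs (st i.+1) k)) (cmap (f (0%N, st 0%N)))
  (fun i => cmap (f (i.+1, st i.+1))).
have bettiP i j : betti F i j != 0%N -> exists k, gshift (f := F) (i := i) k = j.
  by rewrite cards_eq0 => /set0Pn[k]; rewrite inE => /eqP; exists k.
exists F; split.
- split.
  + move=> k; have [_ [[hB _ _] _]] := good 0%N.
    have := vhom_homog_of_degree 0 (hB k); rewrite mxE subr0; exact.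
  + move=> i k l; have [_ [[hB _ _] _]] := good i.+1.
    by have := vhom_homog_of_degree l (hB k); rewrite mxE.
  + move=> p; have [_ [[_ hN _] _]] := good 0%N.
    have := hN (const_mx p); rewrite /= /ideal_rows mxE => ->.
    split=> [[w hw]|[w hw]]; exists w; first by rewrite -hw mxE.
    by apply/matrixP => x y; rewrite !ord1 hw mxE.
  + by move=> v; have [_ [[_ hN _] _]] := good 1%N; apply: hN.
  + by move=> i v; have [_ [[_ hN _] _]] := good i.+2; apply: hN.
- move=> i k l; have [_ [[_ hN _] _]] := good i.+1.
  have [_ [[_ _ hmin] _]] := good i.
  (* Rows of the differential are relations of the previous minimal cover, hence without
     constants. *)
  have hk : kernel (cmap (f (i, st i))) (row k (cmap (f (i.+1, st i.+1)))).
    by apply/hN; exists (delta_mx 0 k); rewrite rowE.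
  by have := hmin _ hk l; rewrite mxE.
- have [[_ _ _ h] [hc _]] := good n.-2.
  have := h (leqnn _); rewrite subnn => /(cover_shift_of_nonzero hc)[k hk].
  exists n.-2, (Posz (r + n.-2)%N); split; last by rewrite PoszD addrK.
  by rewrite cards_eq0; apply/set0Pn; exists k; rewrite inE /= hk.
move=> i j /bettiP[k <-]; have [_ [_ hle]] := good i.
by rewrite lerBlDr -PoszD lez_nat; apply: hle.
Qed.

End IdealRegularity.

(** * Eulerian ideals *)

Section ClassSum.

Variables (K : fieldType) (n : nat) (C : eqType) (kappa : 'X_{1..n} -> C).
Local Notation S := {mpoly K[n]}.

(** Linear forms vanishing on every difference of two monomials of one class; they will cut out both
    ideals below. *)
Definition class_sum (c : C) (p : S) : K := \sum_(m <- msupp p | kappa m == c) p@_m.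

Lemma class_sumwE c p k : (msize p <= k)%N ->
  class_sum c p = \sum_(m : 'X_{1..n < k} | kappa m == c) p@_m.
Proof.
move=> hk; rewrite /class_sum big_mkcond [RHS]big_mkcond.
rewrite (big_mksub 'X_{1..n < k}) //=; first last.
- by move=> x /msize_mdeg_lt /leq_trans; apply.
- by rewrite msupp_uniq.
by rewrite big_rmcond //= => i /memN_msupp_eq0 ->; case: ifP.
Qed.

Lemma class_sum_is_linear c : linear_for *%R (class_sum c).
Proof.
move=> x p q; pose k := maxn (msize (x *: p + q)) (maxn (msize p) (msize q)).
rewrite !(@class_sumwE _ _ k) ?leq_max ?leqnn ?orbT // mulr_sumr -big_split.
by apply: eq_bigr => m _; rewrite mcoeffD mcoeffZ.
Qed.

HB.instance Definition _ c :=
  GRing.isLinear.Build K S K _ (class_sum c) (class_sum_is_linear c).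

Lemma class_sumX c m : class_sum c 'X_[m] = (kappa m == c)%:R.
Proof.
rewrite /class_sum msuppX big_mkcond big_seq1 mcoeffX eqxx.
by case: (kappa m == c).
Qed.

End ClassSum.

(** * The ideal of square differences *)

Section SquareDifferences.

Variables (K : fieldType) (V : finType).
Local Notation R := {mpoly K[#|V|]}.
Local Notation J := (@square_difference_ideal K V).
Local Notation X := (@vertex_var K V).

Lemma sqdiff0 : J 0.
Proof.
exists (fun _ _ => 0); rewrite big1 // => i _; rewrite big1 // => j _.
exact: mul0r.
Qed.

Lemma sqdiffD p q : J p -> J q -> J (p + q).
Proof.
case=> c -> [d ->]; exists (fun i j => c i j + d i j).
rewrite -big_split; apply: eq_bigr => i _; rewrite -big_split.
by apply: eq_bigr => j _; rewrite mulrDl.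
Qed.

Lemma sqdiffM p q : J q -> J (p * q).
Proof.
case=> c ->; exists (fun i j => p * c i j); rewrite mulr_sumr.
by apply: eq_bigr => i _; rewrite mulr_sumr; apply: eq_bigr => j _; rewrite mulrA.
Qed.

Lemma sqdiff_gen i j : J (X i ^+ 2 - X j ^+ 2).
Proof.
exists (fun k l => ((k == i) && (l == j))%:R).
rewrite (bigD1 i) //= (bigD1 j) //= !eqxx mul1r !big1 ?addr0 // => k ki.
  by rewrite big1 // => l _; rewrite (negbTE ki) mul0r.
by rewrite (negbTE ki) andbF mul0r.
Qed.

Definition degree_parity (m : 'X_{1..#|V|}) : nat * {set V} :=
  (mdeg m, [set v | odd (m (enum_rank v))]).

Variable u : V.

Definition odd_part (m : 'X_{1..#|V|}) : 'X_{1..#|V|} :=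
  [multinom nat_of_bool (odd (m i)) | i < #|V|].

(* All the squares dividing a monomial are turned into squares of X u. *)
Definition normal_form (m : 'X_{1..#|V|}) : 'X_{1..#|V|} :=
  (odd_part m + U_(enum_rank u) *+ (mdeg m - mdeg (odd_part m)))%MM.

Lemma mdeg_odd_part m : mdeg m = (mdeg (odd_part m) + \sum_i (m i)./2.*2)%N.
Proof.
rewrite !mdegE -big_split; apply: eq_bigr => i _ /=.
by rewrite mnmE odd_double_half.
Qed.

Lemma degree_parity_normal_form m : degree_parity (normal_form m) = degree_parity m.
Proof.
congr pair.
  rewrite mdegD mdegMn mdeg1 mul1n subnKC //.
  by rewrite (mdeg_odd_part m) leq_addr.
apply/setP => v; rewrite !inE mnmDE oddD mnmE oddb mulmnE oddM.
rewrite (mdeg_odd_part m) addKn (_ : odd (\sum_i _) = false) ?andbF ?addbF //.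
apply: (big_ind (fun x => odd x = false)) => // [x y|i _]; last exact: odd_double.
by rewrite oddD => -> ->.
Qed.

Lemma eq_normal_form m m' :
  degree_parity m = degree_parity m' -> normal_form m = normal_form m'.
Proof.
case=> hd /setP hp; rewrite /normal_form hd; suff -> : odd_part m = odd_part m' by [].
apply/mnmP => i; rewrite !mnmE; congr nat_of_bool.
by have := hp (enum_val i); rewrite !inE enum_valK.
Qed.

(** Congruence modulo J is multiplicative, so each square factor may be exchanged for the square of
    X u. *)
Lemma sqdiff_normal_form m : J ('X_[m] - 'X_[normal_form m]).
Proof.
have mE : m = (odd_part m + \sum_i (U_(i) *+ (m i)./2.*2))%MM.
  apply/mnmP => i; rewrite mnmDE mnmE mnm_sumE (bigD1 i) //= big1 => [|j ji].
    by rewrite mulmnE mnm1E eqxx mul1n addn0 odd_double_half.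
  by rewrite mulmnE mnm1E (negbTE ji).
have congP p q p' q' : J (p - q) -> J (p' - q') -> J (p * p' - q * q').
  move=> h h'; have -> : p * p' - q * q' = p' * (p - q) + q * (p' - q') by ring.
  by apply: sqdiffD; apply: sqdiffM.
have congX p q k : J (p - q) -> J (p ^+ k - q ^+ k).
  move=> h; elim: k => [|k IH]; first by rewrite subrr; apply: sqdiff0.
  by rewrite !exprS; apply: congP.
have -> : 'X_[m] = 'X_[odd_part m] * \prod_i ('X_i ^+ 2) ^+ (m i)./2 :> R.
  rewrite {1}mE mpolyXD -mprodXE; congr (_ * _); apply: eq_bigr => i _.
  by rewrite -exprM mul2n mpolyXn.
have -> : 'X_[normal_form m]
    = 'X_[odd_part m] * \prod_i (X u ^+ 2) ^+ (m i)./2 :> R.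
  rewrite mpolyXD; congr (_ * _); rewrite (mdeg_odd_part m) addKn -mpolyXn.
  by rewrite -prodrXr; apply: eq_bigr => i _; rewrite -exprM mul2n.
apply: (congP); first by rewrite subrr; apply: sqdiff0.
apply: (big_ind2 (fun p q => J (p - q))).
- by rewrite subrr; apply: sqdiff0.
- exact: congP.
move=> i _; apply: congX; rewrite -[i]enum_valK; exact: sqdiff_gen.
Qed.

(** Multiples of generators by monomials are differences within one class. Conversely, passing to
    normal forms changes [q] by an element of J, and the coefficients collected at each normal form
    are class sums, so nothing is left. *)
Lemma square_difference_idealP q :
  J q <-> forall c, class_sum degree_parity c q = 0.
Proof.
split=> [[c ->] e|h].
  rewrite raddf_sum big1 // => i _; rewrite raddf_sum big1 //= => j _.
  rewrite [c i j]mpolyE mulr_suml raddf_sum big1 // => m _ /=.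
  rewrite -scalerAl linearZ mulrBr raddfB /= !mpolyXn -!mpolyXD !class_sumX.
  rewrite (_ : degree_parity _ = degree_parity (m + U_(enum_rank j) *+ 2)%MM).
    by rewrite subrr mulr0.
  congr pair; first by rewrite !mdegD !mdeg1.
  by apply/setP => v; rewrite !inE !mnmDE !addnn !oddD !odd_double.
rewrite [q]mpolyE (_ : \sum_(m <- _) _ =
   \sum_(m <- msupp q) q@_m *: ('X_[m] - 'X_[normal_form m])); last first.
  under [RHS]eq_bigr do rewrite scalerBr.
  rewrite sumrB [X in _ - X](_ : _ = 0) ?subr0 //.
  apply/mpolyP => m; rewrite raddf_sum mcoeff0 /=.
  have -> : \sum_(m' <- msupp q) (q@_m' *: 'X_[normal_form m'])@_m
    = class_sum degree_parity (degree_parity m) q * (normal_form m == m)%:R.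
    rewrite mulr_suml [RHS]big_mkcond; apply: eq_bigr => m' _; rewrite mcoeffZ mcoeffX.
    case: (degree_parity m' =P degree_parity m) => [/eq_normal_form -> //|ne].
    case: eqP => [e|_]; last by rewrite mulr0.
    by case: ne; rewrite -e degree_parity_normal_form.
  by rewrite h mul0r.
apply: (big_ind J); [exact: sqdiff0 | exact: sqdiffD | move=> m _].
by rewrite -mul_mpolyC; apply: sqdiffM; apply: sqdiff_normal_form.
Qed.

End SquareDifferences.

(** * The Eulerian ideal through classes of edge monomials *)

Definition symdiff (T : finType) (A B : {set T}) : {set T} := (A :\: B) :|: (B :\: A).

Lemma in_symdiff (T : finType) (A B : {set T}) x :
  (x \in symdiff A B) = (x \in A) (+) (x \in B).
Proof. by rewrite !inE; case: (x \in A); case: (x \in B). Qed.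

Lemma symdiffK (T : finType) (A B : {set T}) : symdiff (symdiff A B) B = A.
Proof. by apply/setP => x; rewrite !in_symdiff -addbA addbb addbF. Qed.

Section EulerianIdeal.

Variables (K : fieldType) (V : finType) (G : simple_graph V).
Local Notation n := #|edges G|.
Local Notation S := {mpoly K[n]}.
Local Notation I := (@eulerian_ideal K V G).

Definition edge (h : 'I_n) : {set V} := enum_val h.

Lemma card_edge_set h : #|edge h| = 2%N.
Proof. exact: card_edge (enum_valP h). Qed.

Definition edge_class (m : 'X_{1..n}) : nat * {set V} :=
  (mdeg m, [set v | odd (\sum_(h | v \in edge h) m h)]).

Lemma edge_classU h m :
  edge_class (U_(h) + m) = ((mdeg m).+1, symdiff (edge_class m).2 (edge h)).
Proof.
congr pair; first by rewrite mdegD mdeg1.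
apply/setP => v; rewrite in_symdiff !inE.
under eq_bigr do rewrite mnmDE.
rewrite big_split /= oddD addbC; congr (_ (+) _).
case: (boolP (v \in edge h)) => vh.
  rewrite (bigD1 h) //= mnm1E eqxx big1 // => j /andP[_ jh].
  by rewrite mnm1E eq_sym (negbTE jh).
by rewrite big1 // => j vj; rewrite mnm1E; case: eqP vh => // ->; rewrite vj.
Qed.

Definition vertex_monomial (m : 'X_{1..n}) : 'X_{1..#|V|} :=
  [multinom \sum_(h | enum_val i \in edge h) m h | i < #|V|]%N.

Lemma edge_mapX m : @edge_map K V G 'X_[m] = 'X_[vertex_monomial m].
Proof.
rewrite /edge_map comp_mpolyX.
have -> : vertex_monomial m
    = (\sum_h (\sum_(v in edge h) U_(enum_rank v)) *+ m h)%MM.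
  apply/mnmP => i; rewrite mnmE mnm_sumE big_mkcond; apply: eq_bigr => h _ /=.
  rewrite mulmnE mnm_sumE; case: ifPn => ih.
    rewrite (bigD1 (enum_val i)) //= mnm1E enum_valK eqxx big1 ?mul1n // => v /andP[_ vi].
    by rewrite mnm1E (can2_eq enum_rankK enum_valK) (negbTE vi).
  rewrite big1 // => v vh; rewrite mnm1E (can2_eq enum_rankK enum_valK).
  by case: eqP ih => // <-; rewrite vh.
rewrite -mprodXE; apply: eq_bigr => h _; rewrite tnth_mktuple -mpolyXn; congr (_ ^+ _).
by rewrite -mprodXE.
Qed.

Lemma degree_parity_vertex_monomial m :
  degree_parity (vertex_monomial m) = ((mdeg m).*2, (edge_class m).2).
Proof.
congr pair; last by apply/setP => v; rewrite !inE mnmE enum_rankK.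
rewrite !mdegE -muln2 big_distrl /=.
under eq_bigr do rewrite mnmE.
rewrite (exchange_big_dep xpredT) //=; apply: eq_bigr => h _.
rewrite sum_nat_const -(card_edge_set h) mulnC; congr (_ * _)%N.
rewrite -(card_imset (mem (edge h)) enum_rank_inj); apply: eq_card => i.
rewrite -[i \in pred_of_set _]/(i \in _ @: _) -[LHS]/(enum_val i \in edge h).
by rewrite -{2}[i]enum_valK mem_imset //; apply: enum_rank_inj.
Qed.

(** The image of a monomial has twice its degree and the same odd vertices. Doubling is injective,
    so the class sums of p are those of its image. *)
Lemma eulerian_idealP (u : V) p :
  I p <-> forall c, class_sum edge_class c p = 0.
Proof.
have e c : class_sum (@degree_parity V) c (@edge_map K V G p)
   = \sum_(m <- msupp p) p@_m * (((mdeg m).*2, (edge_class m).2) == c)%:R.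
  rewrite /edge_map comp_mpolyEX raddf_sum; apply: eq_bigr => m _.
  by rewrite /= linearZ -/(@edge_map K V G _) edge_mapX /= class_sumX
    degree_parity_vertex_monomial.
have e' c : class_sum edge_class c p
   = \sum_(m <- msupp p) p@_m * (edge_class m == c)%:R.
  rewrite /class_sum big_mkcond; apply: eq_bigr => m _.
  by case: eqP; rewrite ?mulr1 ?mulr0.
rewrite /eulerian_ideal (square_difference_idealP u); split=> h [d T].
  rewrite e' -[RHS](h (d.*2, T)) e; apply: eq_bigr => m _.
  by rewrite !xpair_eqE /= (inj_eq double_inj).
(* No image of a monomial has odd degree. *)
rewrite e; have [od|/even_halfK dE] := boolP (odd d).
  rewrite big1 // => m _; rewrite xpair_eqE; case: eqP => [ed|_]; last by rewrite mulr0.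
  by rewrite -ed odd_double in od.
rewrite -[RHS](h (d./2, T)) e' -{1}dE; apply: eq_bigr => m _.
by rewrite !xpair_eqE /= (inj_eq double_inj).
Qed.

Lemma eulerian_ideal0 : I 0.
Proof. by rewrite /eulerian_ideal /edge_map comp_mpoly0; apply: sqdiff0. Qed.

Lemma eulerian_idealD p q : I p -> I q -> I (p + q).
Proof. by rewrite /eulerian_ideal /edge_map comp_mpolyD; apply: sqdiffD. Qed.

Lemma eulerian_idealM p q : I q -> I (p * q).
Proof. by rewrite /eulerian_ideal /edge_map rmorphM; apply: sqdiffM. Qed.

Variable u : V.

Lemma eulerian_ideal_pihomog d p : I p -> I (pihomog mdeg d p).
Proof.
move/(eulerian_idealP u) => h; apply/(eulerian_idealP u) => -[e T].
rewrite pihomogE raddf_sum /= big_mkcond.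
have [ed|ed] := eqVneq e d; last first.
  rewrite big1 // => m _; case: eqP => // md.
  by rewrite linearZ /= class_sumX xpair_eqE md eq_sym (negbTE ed) mulr0.
rewrite -[RHS](h (e, T)) [in RHS](mpolyE p) raddf_sum; apply: eq_bigr => m _ /=.
rewrite linearZ /= class_sumX xpair_eqE ed; case: eqP => _ //=.
by rewrite mulr0.
Qed.

Lemma class_sum_mulX h d T (p : S) :
  class_sum edge_class (d.+1, T) ('X_h * p)
  = class_sum edge_class (d, symdiff T (edge h)) p.
Proof.
rewrite [p]mpolyE mulr_sumr !raddf_sum; apply: eq_bigr => m _ /=.
rewrite -scalerAr !linearZ /= -mpolyXD !class_sumX edge_classU; congr (_ * _%:R).
rewrite [edge_class m]surjective_pairing !xpair_eqE eqSS; congr (_ && _).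
by apply/eqP/eqP => [<-|/= ->]; rewrite symdiffK.
Qed.

(** Multiplication by 'X_h is injective on classes, so every class sum of p is one of 'X_h times
    p. *)
Lemma eulerian_ideal_regular h p : I ('X_h * p) -> I p.
Proof.
move/(eulerian_idealP u) => hp; apply/(eulerian_idealP u) => -[d T].
by rewrite -[T](symdiffK _ (edge h)) -class_sum_mulX.
Qed.

Lemma eulerian_ideal_binomial m m' :
  edge_class m = edge_class m' -> I ('X_[m] - 'X_[m']).
Proof.
move=> e; apply/(eulerian_idealP u) => c.
by rewrite raddfB /= !class_sumX e subrr.
Qed.

(* [has_monomial d T]: the class (d, T) is a basis element of the quotient ring. *)
Definition has_monomial (d : nat) (T : {set V}) : Prop :=
  exists m, edge_class m = (d, T).

(** Every monomial of [p] is congruent to 'X_h times a monomial of the class provided by the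
    hypothesis. *)
Lemma eulerian_ideal_high (h : 'I_n) d p :
  (forall T, has_monomial d T ->
     exists d', d = d'.+1 /\ has_monomial d' (symdiff T (edge h))) ->
  p \is d.-homog -> exists s, I (p - 'X_h * s).
Proof.
move=> high /dhomogP hp; rewrite [p]mpolyE big_seq.
apply: (big_ind (fun p => exists s, I (p - 'X_h * s))).
- by exists 0; rewrite mulr0 subrr; apply: eulerian_ideal0.
- move=> x y [s hs] [s' hs']; exists (s + s').
  by rewrite mulrDr opprD addrACA; apply: eulerian_idealD.
move=> m /hp /= md; have [|d' [dd' [m' hm']]] := high (edge_class m).2.
  by exists m; rewrite -md.
exists (p@_m *: 'X_[m']); rewrite -scalerAr -scalerBr -mpolyXD -mul_mpolyC.
apply/eulerian_idealM/eulerian_ideal_binomial; rewrite edge_classU hm' symdiffK.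
by rewrite [LHS]surjective_pairing /= md dd'; case: hm' => ->.
Qed.

(** The class sum at (d, T) kills I and all multiples of 'X_h, but takes the value 1 on a monomial
    of that class. *)
Lemma eulerian_ideal_top (h : 'I_n) d T : has_monomial d T ->
  (forall d', d = d'.+1 -> ~ has_monomial d' (symdiff T (edge h))) ->
  exists p, p \is d.-homog /\ forall s, ~ I (p - 'X_h * s).
Proof.
case=> m hm no; exists 'X_[m]; split.
  by rewrite dhomogX; apply/eqP; case: hm.
move=> s /(eulerian_idealP u)/(_ (d, T)); rewrite raddfB /= class_sumX hm eqxx.
rewrite [X in _ - X](_ : _ = 0); first by rewrite subr0; apply/eqP/oner_neq0.
case: d hm no => [|d] hm no.
  rewrite [s]mpolyE mulr_sumr raddf_sum big1 // => m' _ /=.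
  by rewrite -scalerAr linearZ /= -mpolyXD class_sumX edge_classU xpair_eqE mulr0.
rewrite class_sum_mulX [s]mpolyE raddf_sum big1 // => m' _ /=.
rewrite linearZ /= class_sumX; case: eqP => [e|_]; last by rewrite mulr0.
by case: (no d) => //; exists m'.
Qed.

End EulerianIdeal.

(** * Minimum joins *)

Lemma odd_card_symdiff (T : finType) (A B : {set T}) :
  odd #|symdiff A B| = odd #|A| (+) odd #|B|.
Proof.
rewrite -(cardsID B A) -(cardsID A B) (setIC B A) !oddD cardsU.
rewrite (_ : _ :&: _ = set0) ?cards0 ?subn0 ?oddD.
  by case: odd; case: odd; case: odd.
by apply/setP => x; rewrite !inE; case: (x \in A); case: (x \in B).
Qed.

Lemma natr_Z2 a b : (a%:R == b%:R :> 'Z_2) = (odd a == odd b).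
Proof. by rewrite -(inj_eq val_inj) /= !val_Zp_nat // !modn2; do 2!case: odd. Qed.

Section MinJoins.

Variables (V : finType) (G : simple_graph V).
Implicit Types (T : {set V}) (J C : {set {set V}}).

Lemma odd_vertices_symdiff J C :
  odd_vertices (symdiff J C) = symdiff (odd_vertices J) (odd_vertices C).
Proof.
apply/setP => v; rewrite in_symdiff !inE -odd_card_symdiff; congr (odd #|pred_of_set _|).
by apply/setP => h; rewrite !inE; case: (v \in h); rewrite ?andbT ?andbF.
Qed.

Lemma symdiff_join T J C :
  is_join G T J -> even_eulerian G C -> is_join G T (symdiff J C).
Proof.
case/andP=> JG /eqP <- /and3P[CG /forallP evC _]; apply/andP; split.
  apply/subsetP => h; rewrite !inE => /orP[] /andP[_]; exact/subsetP.
rewrite odd_vertices_symdiff; apply/eqP/setP => v.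
by rewrite in_symdiff [X in _ (+) X]inE (negbTE (evC v)) addbF.
Qed.

Lemma symdiff_even_eulerian T J J' : is_join G T J -> is_join G T J' ->
  odd #|J| = odd #|J'| -> even_eulerian G (symdiff J J').
Proof.
case/andP=> JG /eqP oJ /andP[J'G /eqP oJ'] e; apply/and3P; split.
- by apply/subsetP => h; rewrite !inE => /orP[] /andP[_]; apply/subsetP.
- apply/forallP => v; have : v \notin odd_vertices (symdiff J J').
    by rewrite odd_vertices_symdiff in_symdiff oJ oJ' addbb.
  by rewrite inE.
by rewrite odd_card_symdiff e addbb.
Qed.

(* The handshake lemma in every component. *)
Lemma join_even_vertex_sets T J : is_join G T J -> T \in even_vertex_sets G.
Proof.
case/andP=> JG /eqP <-; rewrite inE; apply/forallP => x; set D := component G x.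
have -> : odd #|odd_vertices J :&: D| = odd (\sum_(v in D) edge_degree J v).
  rewrite -sum1_card big_mkcond [in RHS]big_mkcond.
  apply: (big_ind2 (fun a b => odd a = odd b)) => // [a b c d|v _].
    by rewrite !oddD => -> ->.
  rewrite in_setI [v \in odd_vertices J]inE andbC; case: (v \in D) => //=; by case: ifP.
have -> : \sum_(v in D) edge_degree J v = \sum_(h in J) #|h :&: D|.
  under eq_bigr do rewrite /edge_degree -sum1_card.
  rewrite (exchange_big_dep (mem J)) /=; last by move=> v h _; rewrite inE => /andP[].
  apply: eq_bigr => h hJ; rewrite -sum1_card; apply: eq_bigl => v.
  by rewrite !inE hJ andbC.
apply: (big_ind (fun a => ~~ odd a)) => // [a b|h hJ].
  by rewrite oddD => /negbTE -> /negbTE ->.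
have hG := subsetP JG h hJ; have /eqP/cards2P[a [b [ab hab]]] := card_edge hG.
(* Both ends of an edge lie in the same component, so the edge meets D in 0 or 2 vertices. *)
have abD : (a \in D) = (b \in D).
  have adj : adjacent G a b by rewrite /adjacent /= -hab.
  have adj' : adjacent G b a by rewrite /adjacent /= setUC -hab.
  rewrite !inE; apply/idP/idP => h'; apply: (connect_trans h'); exact: connect1.
rewrite hab; case: (boolP (a \in D)) => aD.
  rewrite (setIidPl _) ?cards2 ?ab // subUset !sub1set -abD aD //.
rewrite disjoint_setI0 ?cards0 // disjoints_subset subUset !sub1set !in_setC.
by rewrite -abD aD.
Qed.

Lemma bigminn_attained (I : finType) (P : pred I) (F : I -> nat) x0 :
  (forall i, P i -> \big[minn/x0]_(i | P i) F i <= F i)%N /\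
  (\big[minn/x0]_(i | P i) F i = x0 \/
   exists2 i, P i & \big[minn/x0]_(i | P i) F i = F i).
Proof.
split=> [i Pi|].
  have : i \in index_enum I by rewrite mem_index_enum.
  elim: (index_enum I) => // j s IH; rewrite inE big_cons => /orP[/eqP <-|/IH le].
    by rewrite Pi geq_minl.
  by case: ifP => // _; apply: leq_trans (geq_minr _ _) le.
apply: (big_ind (fun m => m = x0 \/ exists2 i, P i & m = F i)); first by left.
  by move=> a b ha hb; rewrite /minn; case: ifP.
by move=> i Pi; right; exists i.
Qed.

Lemma tau_le i T J : J \in parity_T_joins G i T -> (tau G i T <= #|J|)%N.
Proof. exact: (bigminn_attained _ _ _).1. Qed.

Lemma tau_attained i T : parity_T_joins G i T != set0 ->
  exists2 J, J \in parity_T_joins G i T & #|J| = tau G i T.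
Proof.
case/set0Pn => J hJ; case: (bigminn_attained (mem (parity_T_joins G i T))
    (fun J : {set {set V}} => #|J|) #|edges G|).2 => [e|[J' hJ' e]]; last by exists J'.
(* Should the minimum be the default [#|edges G|], any join attains it, being a set of edges. *)
exists J => //; apply/eqP; rewrite eqn_leq tau_le // andbT.
rewrite [X in (_ <= X)%N]e; apply: subset_leq_card.
by move: hJ; rewrite inE => /andP[/andP[]].
Qed.

Lemma tau_le_max i T : parity_T_joins G i T != set0 -> (tau G i T <= max_tau G)%N.
Proof.
move=> ne; apply: (leq_bigmax_cond (i, T)) => /=; rewrite ne andbT.
by have /set0Pn[J] := ne; rewrite inE => /andP[/join_even_vertex_sets].
Qed.

Lemma max_tau_attained : exists i T J,
  [/\ J \in parity_T_joins G i T, #|J| = tau G i T & tau G i T = max_tau G].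
Proof.
have [|[i T] /andP[_ ne] e] := @eq_bigmax_cond _ [pred p : 'Z_2 * {set V} |
   (p.2 \in even_vertex_sets G) && (parity_T_joins G p.1 p.2 != set0)]
   (fun p => tau G p.1 p.2).
  (* The empty join shows that the maximum runs over a nonempty family. *)
  apply/card_gt0P; exists (0, set0); rewrite inE /=.
  have h : set0 \in parity_T_joins G 0 set0.
    rewrite inE cards0 eqxx andbT /is_join sub0set; apply/eqP/setP => v.
    by rewrite !inE /edge_degree (_ : [set _ in _ | _] = set0) ?cards0 //;
      apply/setP => x; rewrite !inE.
  rewrite (_ : parity_T_joins G 0 set0 != set0); last by apply/set0Pn; exists set0.
  by move: h; rewrite inE => /andP[/join_even_vertex_sets ->].
by have [J hJ eJ] := tau_attained ne; exists i, T, J; split=> //; rewrite /max_tau e.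
Qed.

(** Two joins of the same T and parity differ by an even Eulerian C, and conversely adding C keeps T
    and the parity. The replacement of J by its symmetric difference with C does not shrink J
    exactly when J contains at most half of C. *)
Lemma max_parity_joinE : max_parity_join G = max_tau G.
Proof.
apply/eqP; rewrite eqn_leq; apply/andP; split.
  apply/bigmax_leqP => J /andP[JG /forallP pj].
  have hJ : J \in parity_T_joins G #|J|%:R (odd_vertices J).
    by rewrite inE /is_join JG !eqxx.
  have ne : parity_T_joins G #|J|%:R (odd_vertices J) != set0 by apply/set0Pn; exists J.
  have [J'] := tau_attained ne; rewrite inE natr_Z2 => /andP[jJ' /eqP oJ'] e.
  apply: leq_trans (tau_le_max ne); rewrite -e.
  have jJ : is_join G (odd_vertices J) J by rewrite /is_join JG eqxx.
  have /implyP/(_ (symdiff_even_eulerian jJ jJ' (esym oJ'))) := pj (symdiff J J').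
  have -> : J :&: symdiff J J' = J :\: J'.
    by apply/setP => h; rewrite !inE; case: (h \in J); case: (h \in J').
  have -> : #|symdiff J J'| = (#|J :\: J'| + #|J' :\: J|)%N.
    rewrite cardsU (_ : _ :&: _ = set0) ?cards0 ?subn0 //.
    by apply/setP => h; rewrite !inE; case: (h \in J); case: (h \in J').
  rewrite geq_half_double -addnn leq_add2l => le.
  by rewrite -(cardsID J' J) -(cardsID J J') setIC leq_add2l.
have [i [T [J [hJ eJ <-]]]] := max_tau_attained; rewrite -eJ.
apply: (leq_bigmax_cond (F := fun J : {set {set V}} => #|J|)).
move: (hJ); rewrite inE => /andP[jJ /eqP pJ]; apply/andP; split.
  by case/andP: jJ.
apply/forallP => C; apply/implyP => evC.
have : symdiff J C \in parity_T_joins G i T.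
  rewrite inE symdiff_join //= -pJ natr_Z2 odd_card_symdiff.
  by case/and3P: evC => _ _ /negbTE ->; rewrite addbF.
move/tau_le; rewrite -eJ.
have -> : #|symdiff J C| = (#|J :\: C| + #|C :\: J|)%N.
  rewrite cardsU (_ : _ :&: _ = set0) ?cards0 ?subn0 //.
  by apply/setP => h; rewrite !inE; case: (h \in J); case: (h \in C).
rewrite -(cardsID C J) addnC leq_add2l geq_half_double -addnn -(cardsID J C).
by rewrite setIC leq_add2l.
Qed.

End MinJoins.

(** * Joins as classes of monomials *)

Section Monomials.

Local Open Scope nat_scope.

Variables (V : finType) (G : simple_graph V) (h0 : 'I_#|edges G|).
Local Notation n := #|edges G|.
Implicit Types (T : {set V}) (J : {set {set V}}).

Lemma card_sub_edges J (P : pred {set V}) : J \subset edges G ->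
  #|[set e in J | P e]| = \sum_(h < n | P (edge h)) (edge h \in J).
Proof.
move=> JG; rewrite -sum1_card big_mkcond [RHS]big_mkcond /=.
rewrite -(big_enum_val (fun e => if P e then (e \in J : nat) else 0%N)) /=.
rewrite [RHS]big_mkcond; apply: eq_bigr => e _; rewrite inE.
case: (boolP (e \in J)) => eJ; first by rewrite (subsetP JG) //=; case: (P e).
by case: (e \in edges G) => //=; case: (P e).
Qed.

(** The edges of odd exponent form a join with the same odd vertices and parity; conversely a join
    is padded to degree [d]. *)
Lemma has_monomialP d T :
  has_monomial G d T <->
  exists2 J, J \in parity_T_joins G d%:R T & (#|J| <= d)%N.
Proof.
split=> [[m [md mT]]|[J]].
  pose J := [set edge h | h : 'I_n & odd (m h)].
  have JG : J \subset edges G by apply/subsetP => _ /imsetP[h _ ->]; apply: enum_valP.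
  have memJ h : (edge h \in J) = odd (m h).
    by rewrite mem_imset ?inE //; apply: enum_val_inj.
  have cJ P : #|[set e in J | P e]| = \sum_(h < n | P (edge h)) (odd (m h)).
    by rewrite card_sub_edges //; apply: eq_bigr => h _; rewrite memJ.
  have odd_sum (P : pred 'I_n) :
    odd (\sum_(h | P h) odd (m h)) = odd (\sum_(h | P h) m h).
    apply: (big_ind2 (fun a b => odd a = odd b)) => // [a b c e|h _].
      by rewrite !oddD => -> ->.
    by rewrite oddb.
  have cJ' : #|J| = \sum_(h < n) odd (m h).
    by rewrite -(cJ xpredT); apply: eq_card => e; rewrite inE andbT.
  exists J; last first.
    by rewrite cJ' -md mdegE; apply: leq_sum => h _; case: (m h) => // k; case: odd.
  rewrite inE natr_Z2 cJ' odd_sum -md mdegE eqxx andbT /is_join JG -mT.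
  by apply/eqP/setP => v; rewrite !inE /edge_degree cJ odd_sum.
rewrite inE natr_Z2 => /andP[/andP[JG /eqP <-] /eqP par] le.
pose m0 : 'X_{1..n} := [multinom nat_of_bool (edge h \in J) | h < n].
have m0d : mdeg m0 = #|J|.
  rewrite mdegE (eq_bigr (fun h => nat_of_bool (edge h \in J))); last first.
    by move=> h _; rewrite mnmE.
  by rewrite -(card_sub_edges xpredT JG); apply: eq_card => e; rewrite inE andbT.
(* The exponent added at [h0] is even by the parity condition, so the odd vertices are unchanged. *)
exists (m0 + U_(h0) *+ (d - #|J|))%MM; congr pair.
  by rewrite mdegD mdegMn mdeg1 mul1n m0d subnKC.
apply/setP => v; rewrite !inE /edge_degree (card_sub_edges _ JG).
under eq_bigr do rewrite mnmDE.
rewrite big_split oddD [X in _ (+) X](_ : _ = false) ?addbF.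
  by congr odd; apply: eq_bigr => h _; rewrite mnmE.
apply: (big_ind (fun a => odd a = false)) => // [a b|h _].
  by rewrite oddD => -> ->.
by rewrite mulmnE oddM oddB // par addbb andbF.
Qed.

Lemma has_monomialU d T (h : 'I_n) : has_monomial G d T ->
  has_monomial G d.+1 (symdiff T (edge h)).
Proof. by case=> m hm; exists (U_(h) + m)%MM; rewrite edge_classU; case: hm => <- <-. Qed.

(** A single edge is an odd join, and no join of odd size is empty. *)
Lemma max_tau_gt0 : (0 < max_tau G)%N.
Proof.
have : has_monomial G 1 (edge_class U_(h0)).2.
  by exists U_(h0)%MM; rewrite [LHS]surjective_pairing /= mdeg1.
case/has_monomialP => J hJ _.
have ne : parity_T_joins G 1%:R (edge_class U_(h0)).2 != set0 by apply/set0Pn; exists J.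
apply: leq_trans (tau_le_max ne); have [J' + <-] := tau_attained ne.
by rewrite inE natr_Z2; case: #|J'|; rewrite ?andbF.
Qed.

Lemma max_tau_le_edges : (max_tau G <= n)%N.
Proof.
have [i [T [J [hJ <- <-]]]] := max_tau_attained G.
by apply: subset_leq_card; move: hJ; rewrite inE => /andP[/andP[]].
Qed.

(* A minimum join has size at most d + 1, hence at most d for reasons of parity. *)
Lemma has_monomial_pred d T : (max_tau G <= d.+1)%N ->
  has_monomial G d.+2 T -> has_monomial G d T.
Proof.
move=> rd /has_monomialP[J hJ _]; apply/has_monomialP.
have ne : parity_T_joins G d.+2%:R T != set0 by apply/set0Pn; exists J.
have [J' + e] := tau_attained ne; have le := leq_trans (tau_le_max ne) rd.
rewrite inE natr_Z2 /= negbK => /andP[jJ' /eqP oJ']; exists J'.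
  by rewrite inE natr_Z2 jJ' oJ' eqxx.
move: le; rewrite -e leq_eqVlt => /orP[/eqP e'|//].
by move: oJ'; rewrite e' /=; case: odd.
Qed.

(** Multiplication by the variable of [h0] reaches degree d + 1, and [has_monomial_pred] lowers it
    by two. *)
Lemma has_monomial_high d T : (max_tau G <= d)%N -> has_monomial G d T ->
  exists d', d = d'.+1 /\ has_monomial G d' (symdiff T (edge h0)).
Proof.
case: d => [|d] rd hT; first by move: (leq_trans max_tau_gt0 rd).
by exists d; split=> //; apply: has_monomial_pred => //; apply: has_monomialU.
Qed.

(** A minimum join J of T of maximal size d + 1, multiplied by [h0], gives a class of degree d + 2,
    hence of degree d. Dividing that class by [h0] would give T a join of the same parity smaller
    than J. *)
Lemma has_monomial_top : exists d T,
  [/\ max_tau G = d.+1, has_monomial G d T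
    & forall d', d = d'.+1 -> ~ has_monomial G d' (symdiff T (edge h0))].
Proof.
have [i [T [J [hJ eJ eT]]]] := max_tau_attained G.
have [d rd] : exists d, max_tau G = d.+1.
  by exists (max_tau G).-1; rewrite prednK // max_tau_gt0.
have oJ : #|J|%:R = i by move: hJ; rewrite inE => /andP[_ /eqP].
exists d, (symdiff T (edge h0)); split=> //.
  apply: has_monomial_pred; first by rewrite rd.
  by apply/has_monomialU/has_monomialP; exists J; rewrite -rd -eT -eJ // oJ.
move=> d' dd'; rewrite symdiffK => /has_monomialP[J' hJ' le].
have : (tau G i T <= #|J'|)%N.
  apply: tau_le; move: hJ'; rewrite !inE -oJ !natr_Z2 eJ eT rd dd' /= negbK.
  move=> /andP[-> /eqP ->].
  by rewrite eqxx.
by rewrite eT rd dd' => le'; have := leq_trans le' le; rewrite ltnNge leqnSn.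
Qed.

End Monomials.

(** * Regularity of the Eulerian ideal *)

Section MaxTauRegularity.

Variables (K : fieldType) (V : finType) (G : simple_graph V) (u : V).
Local Notation n := #|edges G|.
Local Notation I := (@eulerian_ideal K V G).

(** In one variable the degree determines the monomial, so class sums are coefficients. *)
Lemma eulerian_ideal_single_edge p : n = 1%N -> I p -> p = 0.
Proof.
move=> n1 /(eulerian_idealP u) hp.
have ordE (i j : 'I_n) : i = j.
  by apply: val_inj; case: i j => [i hi] [j hj] /=;
    move: hi hj; rewrite n1; case: i; case: j.
have mE (m : 'X_{1..n}) i : mdeg m = m i.
  by rewrite mdegE (big_pred1 i) // => j; rewrite (ordE j i) /= eqxx.
apply/mpolyP => m; rewrite mcoeff0 -(hp (edge_class m)).
rewrite [in RHS](mpolyE p) raddf_sum [in LHS](mpolyE p) raddf_sum.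
apply: eq_bigr => m' _ /=; rewrite mcoeffZ mcoeffX linearZ /= class_sumX.
congr (_ * _%:R); congr nat_of_bool; apply/eqP/eqP => [-> //|[e _]].
by apply/mnmP => i; rewrite -!mE.
Qed.

Lemma eulerian_ideal_nonzero : (1 < n)%N -> exists2 p, I p & p != 0.
Proof.
move=> n2; pose h := Ordinal (ltnW n2); pose k := Ordinal n2.
exists ('X_h ^+ 2 - 'X_k ^+ 2); last first.
  apply/eqP => /mpolyP/(_ (U_(h) *+ 2)%MM); rewrite mcoeffB !mcoeffXn eqxx mcoeff0.
  have -> : (U_(k) *+ 2 == U_(h) *+ 2 :> 'X_{1..n})%MM = false.
    by apply/eqP => /mnmP/(_ k); rewrite !mulmnE !mnm1E eqxx.
  by rewrite subr0; apply/eqP/oner_neq0.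
have e (j : 'I_n) : 'X_j ^+ 2 = 'X_[U_(j) + (U_(j) + 0)] :> {mpoly K[n]}.
  by rewrite !mpolyXD mpolyX0 mulr1.
rewrite !e; apply: (eulerian_ideal_binomial _ u); rewrite !edge_classU /= !symdiffK.
by rewrite !mdegD !mdeg1.
Qed.

Lemma has_regularity_max_tau : edges G != set0 ->
  has_regularity I (Posz (max_tau G)).
Proof.
rewrite -card_gt0 => n0; pose h0 := Ordinal n0.
have [n1|n2] : n = 1%N \/ (1 < n)%N.
  by have := n0; rewrite leq_eqVlt => /orP[/eqP|]; [left|right].
  (* The zero ideal has regularity 1 by convention, and [max_tau] is positive and at most the number
     of edges, here 1. *)
  left; split=> [p|]; first exact: eulerian_ideal_single_edge.
  congr Posz; apply/eqP; rewrite eqn_leq max_tau_gt0 // andbT -n1.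
  exact: max_tau_le_edges.
right; split; first exact: eulerian_ideal_nonzero.
apply: (@regular_resolution K n I h0) => //.
- exact: eulerian_ideal0.
- exact: eulerian_idealD.
- exact: eulerian_idealM.
- exact: eulerian_ideal_pihomog.
- exact: eulerian_ideal_regular.
- move=> d p rd; apply: (eulerian_ideal_high u) => T; exact: has_monomial_high.
have [d [T [rd hT no]]] := has_monomial_top h0.
have [p [hp top]] := eulerian_ideal_top K u hT no.
by exists d, p; split.
Qed.

End MaxTauRegularity.

Theorem theorem4p13 (K : fieldType) (V : finType) (G : simple_graph V)
    (hiso : no_isolated_vertex G) (hE : edges G != set0) :
  has_regularity (@eulerian_ideal K V G) (Posz (max_tau G)) /\
  has_regularity (@eulerian_ideal K V G) (Posz (max_parity_join G)).
Proof.
have [h hG] := set0Pn _ hE.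
(* An endpoint of an edge serves as base vertex of the normal forms. *)
have [u _] : exists u, u \in h by apply/card_gt0P; rewrite (card_edge hG).
by rewrite max_parity_joinE; split; apply: has_regularity_max_tau.
Qed.
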